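(* Let $\mathcal{D} = \{(T_\theta, f_\theta) : \theta \in \Theta\}$ be a continuous family of dynamical models on a compact metric space $\mathcal{X}$. Suppose that (i) $h(\mathcal{D}) > 0$; (ii) there exists $\theta_0 \in \Theta$ such that $h(\mathcal{D}_{\theta_0}) = 0$ and $\mathcal{Q}_{\theta_0} \setminus \bigcup_{\theta \neq \theta_0} \mathcal{Q}_\theta$ contains an ergodic process $\mathbf{V}$. Then there exists $\sigma_0 > 0$ such that for every i.i.d. process $\boldsymbol{\varepsilon} = (\varepsilon_k)_{k\ge 0}$, independent of $\mathbf{V}$, with $\varepsilon_i \sim N(0,\sigma^2)$ for some $\sigma > \sigma_0$, the least squares estimates derived from $\mathbf{Y} = \mathbf{V} + \boldsymbol{\varepsilon}$ converge almost surely to a compact set $\Theta_* \subseteq \Theta$ such that $\mathbf{V} \notin \bigcup_{\theta\in\Theta_*} \mathcal{Q}_\theta$. Moreover, there exists a continuous family $\mathcal{D} = \{(T_\theta, f_\theta) : \theta \in \Theta\}$ of dynamical models on a compact metric space $\mathcal{X}$ such that $h(\mathcal{D}) > 0$ and such that, for some $\theta_0 \in \Theta$, $h(\mathcal{D}_{\theta_0}) = 0$ and $\mathcal{Q}_{\theta_0} \setminus \bigcup_{\theta \neq \theta_0} \mathcal{Q}_\theta$ contains an ergodic process.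
   Context: **Dynamical models.** Let $\mathcal{X}$ be a (nonempty) compact metric space. A continuous family of dynamical models on $\mathcal{X}$ is an indexed family $\mathcal{D} = \{(T_\theta, f_\theta) : \theta \in \Theta\}$ of maps $T_\theta : \mathcal{X} \to \mathcal{X}$ and $f_\theta : \mathcal{X} \to \mathbb{R}$ such that $\Theta$ is a (nonempty) compact metric space, the map $(\theta, x) \mapsto T_\theta(x)$ from $\Theta \times \mathcal{X}$ to $\mathcal{X}$ is continuous, and the map $(\theta,x) \mapsto f_\theta(x)$ from $\Theta \times \mathcal{X}$ to $\mathbb{R}$ is continuous. $T_\theta^k$ is the $k$-fold composition of $T_\theta$ ($T_\theta^0 = \mathrm{Id}$). $\mathcal{D}_\theta = \{(T_\theta,f_\theta)\}$ is the family consisting of the single model with parameter $\theta$. **Associated processes.** $\mathcal{M}(\mathcal{X}, T_\theta)$ is the set of Borel probability measures on $\mathcal{X}$ invariant under $T_\theta$. $\mathcal{Q}_\theta$ is the set of stationary processes $\mathbf{U} = (f_\theta \circ T_\theta^k(X))_{k \geq 0}$ with $X \sim \mu$, $\mu \in \mathcal{M}(\mathcal{X},T_\theta)$. Processes are identified with their laws on $\mathbb{R}^{\mathbb{N}}$, $\mathbb{N} = \{0,1,2,\dots\}$. **Least squares estimates.** For $\theta \in \Theta$, $x \in \mathcal{X}$, let $R_n(\theta : x) = \frac1n \sum_{k=0}^{n-1} (f_\theta \circ T_\theta^k(x) - Y_k)^2$. A sequence of measurable functions $\theta_n : \mathbb{R}^n \to \Theta$, $n \geq 1$, with $\hat\theta_n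 := \theta_n(Y_0, \ldots, Y_{n-1})$, is a sequence of least squares estimates (minimum risk estimates for the squared loss) if, with probability one, the limit on the left below exists and $\lim_n \inf_{x} R_n(\hat\theta_n : x) = \lim_n \inf_\theta \inf_x R_n(\theta : x)$ (the limit on the right exists almost surely). The convergence assertion is for any such sequence of estimates, with the same set $\Theta_*$; convergence to a set means that the distance from $\hat\theta_n$ to the set tends to $0$. **Sum of processes.** $\mathbf{Y} = \mathbf{V} + \boldsymbol{\varepsilon}$ means $Y_k = V_k+\varepsilon_k$ for all $k \ge 0$. **Entropy of a family.** For $\mathbf{u},\mathbf{v} \in \mathbb{R}^{\mathbb{N}}$ let $d_{n,p}(\mathbf{u},\mathbf{v}) = (n^{-1}\sum_{k=0}^{n-1}|u_k-v_k|^p)^{1/p}$ for $1\le p<\infty$ and $d_{n,\infty}(\mathbf{u},\mathbf{v}) = \max_{0 \leq k \leq n-1}|u_k-v_k|$. For $\mathcal{U} \subseteq \mathbb{R}^{\mathbb{N}}$ let $N(\mathcal{U},r,d_{n,p})$ be the covering number of $\mathcal{U}$ at radius $r$ under $d_{n,p}$, $h_p(\mathcal{U},r) = \limsup_n \frac1n \log N(\mathcal{U},r,d_{n,p})$, and $h_p(\mathcal{U}) = \lim_{r\searrow 0} h_p(\mathcal{U},r)$. The value $h_p(\mathcal{U})$ does not depend on $p \in [1,\infty]$. The entropy $h(\mathcal{D})$ of a family is the common value of $h_p(\mathcal{U}_{\mathcal{D}})$, where $\mathcal{U}_{\mathcal{D}} = \{(f_\theta\circ T_\theta^k(x))_{k\ge0}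 : x \in \mathcal{X}, \theta\in\Theta\}$. *)

(* Defs.v *)
From HB Require Import structures.
From mathcomp Require Import all_boot all_order all_algebra.
From mathcomp Require Import all_classical all_reals all_analysis.

Set Implicit Arguments.
Unset Strict Implicit.
Unset Printing Implicit Defensive.

Import Order.TTheory GRing.Theory Num.Theory.
Import numFieldNormedType.Exports.

Local Open Scope classical_set_scope.
Local Open Scope ring_scope.

(* Nonempty metric spaces: the point only witnesses nonemptiness (measurable
   types have to be pointed). *)
#[short(type="pmetricType")]
HB.structure Definition PointedMetric (R : numDomainType) :=
  { T of Pointed T & Metric R T }.

Definition borel (R : numDomainType) (X : pmetricType R) : Type :=
  g_sigma_algebraType [set A : set X | open A].

HB.instance Definition _ (R : numDomainType) (X : pmetricType R) :=
  Measurable.on (borel X).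

(* The space of sequences nat -> R with its product sigma-algebra, generated by
   the coordinate maps. *)
Definition cylinders (R : realType) : set (set (nat -> R)) :=
  [set C | exists (k : nat) (A : set R),
     measurable A /\ C = [set u | A (u k)]].

Definition seq_space (R : realType) : Type := g_sigma_algebraType (@cylinders R).

HB.instance Definition _ (R : realType) := Measurable.on (seq_space R).

Section Processes.
Context {R : realType}.

Definition shift (u : seq_space R) : seq_space R := fun k => u k.+1.

(* A process is identified with its law on the sequence space. *)
Definition stationary (nu : probability (seq_space R) R) : Prop :=
  forall A : set (seq_space R), measurable A -> nu (shift @^-1` A) = nu A.

Definition ergodic (nu : probability (seq_space R) R) : Prop :=
  stationary nu /\
  forall A : set (seq_space R), measurable A -> shift @^-1` A = A ->
    nu A = 0%E \/ nu A = 1%E.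

Context d (Omega : measurableType d) (P : probability Omega R).
Implicit Types U V : nat -> {RV P >-> R}.

Definition path_of U (w : Omega) : seq_space R := fun k => U k w.

Definition has_law U (nu : probability (seq_space R) R) : Prop :=
  forall A : set (seq_space R), measurable A -> P (path_of U @^-1` A) = nu A.

Definition independent_processes U V : Prop :=
  forall A B : set (seq_space R), measurable A -> measurable B ->
    P ((path_of U @^-1` A) `&` (path_of V @^-1` B)) =
    (P (path_of U @^-1` A) * P (path_of V @^-1` B))%E.

Definition mutually_independent U : Prop :=
  forall (s : seq nat) (A : nat -> set R),
    uniq s -> (forall k, measurable (A k)) ->
    P (\bigcap_(k in [set` s]) (U k @^-1` A k)) =
    (\prod_(k <- s) P (U k @^-1` A k))%E.

(* [normal_prob m s] has standard deviation s, i.e. variance s ^+ 2. *)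
Definition iid_centered_normal U (sigma : R) : Prop :=
  mutually_independent U /\
  forall (k : nat) (A : set R), measurable A ->
    distribution P (U k) A = normal_prob 0 sigma A.

End Processes.

Section Entropy.
Context {R : realType}.
Local Open Scope ereal_scope.

(* The pseudometric d_{n,p}, meant for p in [1, +oo]. *)
Definition dist_np (n : nat) (p : \bar R) (u v : nat -> R) : R :=
  if p is q%:E then
    ((n%:R^-1 * \sum_(k < n) `|u k - v k| `^ q) `^ q^-1)%R
  else \big[Num.max/0%R]_(k < n) `|u k - v k|%R.

(* Least number of open balls of radius r needed to cover U (+oo if no finite
   number suffices); the centers need not belong to U. *)
Definition covering_number (U : set (nat -> R)) (r : R)
    (dist : (nat -> R) -> (nat -> R) -> R) : \bar R :=
  ereal_inf [set N%:R%:E | N in [set N : nat |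
    exists c : 'I_N -> nat -> R,
      forall u, U u -> exists i, (dist u (c i) < r)%R]].

Definition entropy_at (p : \bar R) (U : set (nat -> R)) (r : R) : \bar R :=
  limn_esup (fun n : nat =>
    n%:R^-1%:E * lne (covering_number U r (dist_np n p))).

Definition seq_entropy (p : \bar R) (U : set (nat -> R)) : \bar R :=
  lim (entropy_at p U r @[r --> (0%R : R)^'+]).

End Entropy.

Section DynamicalModels.
Context {R : realType} {X Theta : pmetricType R}.
Variables (T : Theta -> X -> X) (f : Theta -> X -> R).

Definition continuous_family : Prop :=
  [/\ compact [set: X], compact [set: Theta],
      continuous (fun z : Theta * X => T z.1 z.2)
    & continuous (fun z : Theta * X => f z.1 z.2)].

Definition orbit_seq (theta : Theta) (x : X) : nat -> R :=
  fun k => f theta (iter k (T theta) x).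

(* The entropy h of the subfamily with parameters in S, computed with d_{n,p}:
   S = setT gives the whole family, S = [set theta] a single model. Its value
   does not depend on p in [1, +oo]. *)
Definition entropy (p : \bar R) (S : set Theta) : \bar R :=
  seq_entropy p
    [set u | exists theta x, S theta /\ u = orbit_seq theta x].

Definition invariant (theta : Theta) (mu : probability (borel X) R) : Prop :=
  forall A : set (borel X), measurable A -> mu (T theta @^-1` A) = mu A.

Definition model_processes (theta : Theta) :
    set (probability (seq_space R) R) :=
  [set nu | exists mu : probability (borel X) R, invariant theta mu /\
     forall A : set (seq_space R), measurable A ->
       nu A = mu (orbit_seq theta @^-1` A)].

Definition emp_risk (y : nat -> R) (n : nat) (theta : Theta) (x : X) : R :=
  n%:R^-1 * \sum_(k < n) (orbit_seq theta x k - y k) ^+ 2.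

Definition min_risk (y : nat -> R) (n : nat) (theta : Theta) : R :=
  inf (range (emp_risk y n theta)).

Definition estimate (theta_ : forall n : nat, n.-tuple R -> Theta)
    (y : nat -> R) (n : nat) : Theta :=
  theta_ n [tuple y k | k < n].

Definition least_squares_estimates d (Omega : measurableType d)
    (P : probability Omega R) (Y : nat -> Omega -> R)
    (theta_ : forall n : nat, n.-tuple R -> Theta) : Prop :=
  (forall n, measurable_fun [set: n.-tuple R]
     (theta_ n : n.-tuple R -> borel Theta)) /\
  {ae P, forall w, let y := fun k => Y k w in
     exists l : R,
       min_risk y n (estimate theta_ y n) @[n --> \oo] --> l /\
       inf (range (min_risk y n)) @[n --> \oo] --> l}.

End DynamicalModels.

Definition dist_to_set (R : realType) (M : pmetricType R) (A : set M) (x : M) :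
    \bar R :=
  ereal_inf [set (mdist x a)%:E | a in A].

(* Main.v *)
Require Import Defs.
From HB Require Import structures.
From mathcomp Require Import all_boot all_order all_algebra.
From mathcomp Require Import all_classical all_reals all_analysis.
From mathcomp Require Import measurable_realfun ring lra.

Set Implicit Arguments.
Unset Strict Implicit.
Unset Printing Implicit Defensive.

Import Order.TTheory GRing.Theory Num.Theory.
Import numFieldNormedType.Exports.

Local Open Scope classical_set_scope.
Local Open Scope ring_scope.

(* Expanding the square, the risk of an orbit [u] is, up to a term common to all
   models, [|u - v|^2 / n - 2 <u - v, eps> / n].  Near [theta0] the orbits of
   length [n] follow [exp (o(n))] words, so by a union bound they (and the paths
   of [V]) have correlation [o(n)] with the noise.  Positive entropy yields
   exponentially many orbits at mutual l^2-distance of order [sqrt n]; if none of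
   them had correlation at least [c sigma n] with the noise, they would form a
   code for the Gaussian channel whose decoding regions are disjoint, which
   contradicts the Cameron-Martin formula.  For large [sigma] the gain
   [2 c sigma] exceeds the bounded cost [|u - v|^2 / n], so the estimates
   eventually leave a fixed neighbourhood of [theta0], and the complement of that
   neighbourhood serves as [Theta_star]. *)

(** * Covering numbers and entropy *)

Section SupCover.
Context {R : realType}.
Implicit Types (U : set (nat -> R)) (r : R) (n K : nat).

(** Entropy is given in some [d_{n,p}], whereas the argument needs covers in the sup norm: closeness
    in every coordinate survives cutting a sequence into blocks and can be tested on the paths of
    [V]. The passage rests on the fact that a small [d_{n,p}] distance leaves only a small fraction
    of bad coordinates, and correcting these costs an arbitrarily small exponential rate. The order
    of the choices is the delicate point. A threshold [sigma0] exists only if the constant [c] in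
    the gain [2 c sigma] is found before [sigma]. For this reason the codewords are the separated
    orbits multiplied by [sigma] and by a fixed small factor: [sigma] then cancels both from the
    disjointness of the decoding regions and from the size of the Cameron-Martin density on them.
    The neighbourhood of [theta0], by contrast, may shrink as [sigma] grows; [Theta_star] may
    therefore depend on [sigma], but it is fixed before the estimates are. *)

Definition sup_cover U n r K : Prop :=
  exists c : 'I_K -> nat -> R, forall u, U u ->
    exists i, forall k, (k < n)%N -> `|u k - c i k| < r.

Lemma sup_cover_fin (I : finType) (c : I -> nat -> R) U n r :
  (forall u, U u -> exists i, forall k, (k < n)%N -> `|u k - c i k| < r) ->
  sup_cover U n r #|I|.
Proof.
move=> cP; exists (c \o enum_val) => u /cP[i iP].
by exists (enum_rank i) => k kn /=; rewrite enum_rankK; exact: iP.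
Qed.

(** Generating function of the support size. The weight is a product over coordinates, so the sum
    factors; in each factor [None] contributes 1 and each of the [L] values contributes
    [expR (- s)]. *)
Lemma sum_le_supp_ffun n (L : nat) (s : R) :
  \sum_(a : {ffun 'I_n -> option 'I_L})
     expR (- (s * #|[pred k | a k != None]|%:R)) = (1 + L%:R * expR (- s)) ^+ n.
Proof.
pose F (k : 'I_n) (o : option 'I_L) : R := if o == None then 1 else expR (- s).
transitivity (\prod_(k < n) \sum_(o : option 'I_L) F k o); last first.
  rewrite (eq_bigr (fun=> 1 + L%:R * expR (- s))); last first.
    move=> k _; rewrite (bigD1 None)//= /F eqxx; congr (_ + _).
    rewrite (eq_bigr (fun=> expR (- s))); last by move=> o /negbTE ->.
    rewrite sumr_const -[in LHS]mulr_natl; congr (_%:R * _).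
    by rewrite (cardC1 None) card_option card_ord.
  by rewrite prodr_const card_ord.
rewrite bigA_distr_bigA; apply: eq_bigr => a _.
rewrite (bigID (fun k => a k == None))/= big1 ?mul1r; last first.
  by move=> k; rewrite /F => ->.
rewrite (eq_bigr (fun=> expR (- s))); last by move=> k; rewrite /F => /negbTE ->.
rewrite prodr_const -expRM_natl; congr expR.
rewrite mulrN [in RHS]mulrC; congr (- (s * _%:R)).
Qed.

(** Exponential Markov bound: each function counted has [expR (s * (b - size of its support)) >= 1].
    The generating function is then estimated by [1 + x <= expR x]. *)
Lemma card_sparse_ffun n (L : nat) (s b : R) : 0 <= s ->
  #|[pred a : {ffun 'I_n -> option 'I_L} | #|[pred k | a k != None]|%:R <= b]|%:R
    <= expR (s * b + n%:R * (L%:R * expR (- s))).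
Proof.
move=> s0; rewrite expRD.
apply: (@le_trans _ _ (expR (s * b) * (1 + L%:R * expR (- s)) ^+ n)); last first.
  rewrite ler_pM2l ?expR_gt0// expRM_natl.
  apply: lerXn2r; rewrite ?nnegrE ?expR_ge0 ?expR_ge1Dx//.
rewrite -sum_le_supp_ffun mulr_sumr -sum1_card natr_sum.
rewrite big_mkcond ler_sum// => a _; rewrite inE -expRD.
case: ifPn => [ab|_]; last exact: expR_ge0.
by rewrite -[X in X <= _]expR0 ler_expR -mulrBr mulr_ge0 ?subr_ge0.
Qed.

Lemma grid (M r : R) : 0 < r -> exists (L : nat) (g : 'I_L -> R),
  forall x, `|x| <= M -> exists j, `|x - g j| < r.
Proof.
move=> r0.
pose L := (Num.truncn (2 * M / r)).+1.
exists L, (fun j => - M + j%:R * r) => x xM.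
have := xM; rewrite ler_norml => /andP[x1 x2].
have y0 : 0 <= (x + M) / r by rewrite divr_ge0 ?(ltW r0)//; lra.
have jL : (Num.truncn ((x + M) / r) < L)%N.
  rewrite ltnS; apply: le_truncn.
  by rewrite ler_pM2r ?invr_gt0//; lra.
exists (Ordinal jL) => /=.
have /andP[] := truncn_itv y0.
move: (Num.truncn _) => m.
rewrite ler_pdivlMr// ltr_pdivrMr// -natr1 mulrDl mul1r => h1 h2.
by rewrite ltr_norml; apply/andP; split; lra.
Qed.

(* The few coordinates where a center is bad are corrected by grid values, at the
   price of a small exponential factor in the number of centers. *)
Lemma sup_cover_sparse (M r eta : R) : 0 < r -> 0 < eta ->
  exists2 alpha : R, 0 < alpha &
  forall U n K (c : 'I_K -> nat -> R),
    (forall u k, U u -> `|u k| <= M) ->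
    (forall u, U u -> exists i,
       #|[pred k : 'I_n | r <= `|u k - c i k|]|%:R <= alpha * n%:R) ->
    exists2 K' : nat, sup_cover U n r K' & K'%:R <= K%:R * expR (eta * n%:R).
Proof.
move=> r0 e0.
have [L [g gP]] := grid M r0.
(* Large enough for [L * expR (- s) <= eta / 2]. With the fraction [eta / (2 * s)] of corrected
   coordinates, each of the two terms of the exponent in [card_sparse_ffun] is then at most
   [eta / 2 * n]. *)
pose s : R := Num.max 1 (ln (2 * (L%:R + 1) / eta)).
have s1 : 1 <= s by rewrite le_max lexx.
have s0 : 0 < s by rewrite (lt_le_trans _ s1).
have Ls : L%:R * expR (- s) <= eta / 2.
  have z0 : 0 < 2 * (L%:R + 1) / eta by rewrite divr_gt0// mulr_gt0// ltr_wpDl.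
  have : expR (ln (2 * (L%:R + 1) / eta)) <= expR s by rewrite ler_expR le_max lexx orbT.
  rewrite lnK// => h.
  rewrite expRN ler_pdivrMr ?expR_gt0//.
  apply: (@le_trans _ _ (eta / 2 * (2 * (L%:R + 1) / eta))); last first.
    by rewrite ler_pM2l// divr_gt0.
  rewrite (_ : eta / 2 * _ = L%:R + 1); first by rewrite lerDl.
  by field; rewrite gt_eqF.
exists (eta / (2 * s)); first by rewrite divr_gt0// mulr_gt0.
move=> U n K c UM Uc.
pose A := [pred a : {ffun 'I_n -> option 'I_L} |
  #|[pred k | a k != None]|%:R <= eta / (2 * s) * n%:R].
pose I : finType := ('I_K * {a | a \in A})%type.
pose d (i : I) (k : nat) : R :=
  if insub k is Some k' then
    if val i.2 k' is Some j then g j else c i.1 k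
  else 0.
exists #|I|.
  apply: (@sup_cover_fin I d) => u Uu.
  have [i iP] := Uc u Uu.
  have gE (k : nat) : exists j, `|u k - g j| < r by apply: gP; exact: UM.
  have /choice[J JP] := gE.
  pose a : {ffun 'I_n -> option 'I_L} :=
    [ffun k : 'I_n => if r <= `|u k - c i k| then Some (J k) else None].
  have aA : a \in A.
    rewrite inE; apply: le_trans iP; rewrite ler_nat subset_leq_card//.
    by apply/fintype.subsetP => k; rewrite !inE ffunE; case: ifP.
  exists (i, exist _ a aA) => k kn.
  rewrite /d insubT/= ffunE/=.
  by case: ifPn => // h; rewrite ltNge.
rewrite card_prod card_ord card_sig natrM ler_wpM2l//.
rewrite (_ : eta * n%:R = s * (eta / (2 * s) * n%:R) + n%:R * (eta / 2)); last first.
  by field; rewrite gt_eqF.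
apply: (le_trans (card_sparse_ffun _ _ _ (ltW s0))).
by rewrite ler_expR lerD2l ler_wpM2l.
Qed.

End SupCover.

(** * Entropy in terms of sup-norm covers *)

Section CoverEntropy.
Context {R : realType}.
Implicit Types (U : set (nat -> R)) (r : R) (n K N : nat) (p : \bar R).

Lemma dist_np_le n p (u c : nat -> R) (s : R) : (1 <= p)%E -> 0 <= s ->
  (forall k, (k < n)%N -> `|u k - c k| <= s) -> dist_np n p u c <= s.
Proof.
move=> p1 s0 us; rewrite /dist_np; case: p p1 => [q| |]// q1; last first.
  by apply: bigmax_le => // k _; exact: us.
rewrite lee_fin in q1; have q0 : 0 < q by rewrite (lt_le_trans _ q1).
have -> : s = (s `^ q) `^ q^-1 by rewrite -powRrM divff ?gt_eqF// powRr1.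
have S0 : 0 <= n%:R^-1 * \sum_(k < n) `|u k - c k| `^ q.
  by rewrite mulr_ge0// sumr_ge0// => k _; exact: powR_ge0.
apply: ge0_ler_powR; rewrite ?nnegrE ?invr_ge0 ?powR_ge0 ?(ltW q0)//.
have [->|n0] := posnP n; first by rewrite invr0 mul0r powR_ge0.
rewrite ler_pdivrMl ?ltr0n// mulrC mulr_natr.
rewrite -[X in _ <= _ *+ X]card_ord -sumr_const ler_sum// => k _.
by apply: ge0_ler_powR; rewrite ?nnegrE ?(ltW q0)//; exact: us.
Qed.

(** Markov's inequality for the uniform measure on the [n] coordinates. For [p = +oo] there are no
    bad coordinates at all once [rho = r]. *)
Lemma dist_np_sparse p (r alpha : R) : (1 <= p)%E -> 0 < r -> 0 < alpha ->
  exists2 rho : R, 0 < rho & forall n (u c : nat -> R), dist_np n p u c < rho ->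
    #|[pred k : 'I_n | r <= `|u k - c k|]|%:R <= alpha * n%:R.
Proof.
move=> p1 r0 a0; case: p p1 => [q| |]// q1; last first.
  exists r => // n u c; rewrite /dist_np => ur.
  rewrite (_ : #|_| = 0%N); first by rewrite mulr_ge0// ltW.
  apply: eq_card0 => k; rewrite !inE; apply/negbTE; rewrite -ltNge.
  apply: le_lt_trans ur.
  exact: (@le_bigmax _ _ _ _ (fun k : 'I_n => `|u k - c k|)).
rewrite lee_fin in q1; have q0 : 0 < q by rewrite (lt_le_trans _ q1).
(* The cap at 1 gives [b ^ q <= b <= alpha] for [q >= 1]. *)
pose b := Num.min alpha 1.
have b0 : 0 < b by rewrite lt_min a0 ltr01.
have b1 : b <= 1 by rewrite ge_min lexx orbT.
exists (r * b); first exact: mulr_gt0.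
move=> n u c /=; set S := \sum_(k < n) _; set B := [pred k | _].
have [n0|n0] := posnP n.
  move=> _; rewrite (_ : #|B| = 0%N) ?mulr_ge0 ?(ltW a0)//.
  by apply: eq_card0 => -[k kn]; exfalso; rewrite n0 in kn.
have n0' : 0 < n%:R :> R by rewrite ltr0n.
have S0 : 0 <= S by rewrite sumr_ge0// => k _; exact: powR_ge0.
have nS0 : 0 <= n%:R^-1 * S by rewrite mulr_ge0.
move=> h.
have {}h : n%:R^-1 * S < (r * b) `^ q.
  have := gt0_ltr_powR q0 _ _ h.
  rewrite !nnegrE powR_ge0 (ltW (mulr_gt0 r0 b0)) => /(_ isT isT).
  by rewrite -powRrM mulVf ?gt_eqF// powRr1.
have hB : #|B|%:R * r `^ q <= S.
  rewrite mulrC mulr_natr -sumr_const /S.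
  rewrite [leRHS](bigID (mem B))/=.
  apply: ler_wpDr; first by rewrite sumr_ge0// => k _; exact: powR_ge0.
  rewrite ler_sum// => k; rewrite inE => rk.
  by apply: ge0_ler_powR; rewrite ?nnegrE// ltW.
have rq0 : 0 < r `^ q by rewrite powR_gt0.
rewrite -(ler_pM2r rq0); apply: (le_trans hB).
rewrite ltr_pdivrMl// in h; apply: (le_trans (ltW h)).
rewrite powRM ?(ltW r0) ?(ltW b0)// mulrCA [leRHS]mulrC ler_pM2l//.
rewrite mulrC ler_pM2r//.
apply: (@le_trans _ _ b); last by rewrite ge_min lexx.
by rewrite -[leRHS](powRr1 (ltW b0)) ger_powR ?b0.
Qed.

Lemma limn_esup_le (a : (\bar R)^nat) (l : \bar R) :
  (\forall n \near \oo, (a n <= l)%E) -> (limn_esup a <= l)%E.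
Proof.
move=> al; apply: (@le_trans _ _ (ereal_sup (a @` [set n | (a n <= l)%E]))).
  by apply: ereal_inf_lbound; exists [set n | (a n <= l)%E].
by apply: ge_ereal_sup => _ [n /= an <-].
Qed.

Lemma limn_esup_lt (a : (\bar R)^nat) (l : \bar R) :
  (limn_esup a < l)%E -> \forall n \near \oo, (a n < l)%E.
Proof.
move=> /ereal_inf_lt[_ [V oV <-] Vl].
near=> n; apply: le_lt_trans Vl; apply: ereal_sup_ubound; exists n => //.
by near: n.
Unshelve. all: by end_near. Qed.

Lemma le_limn_esup (a b : (\bar R)^nat) :
  (forall n, (a n <= b n)%E) -> (limn_esup a <= limn_esup b)%E.
Proof.
move=> ab; apply: le_ereal_inf_tmp => _ [V oV <-].
apply: (@le_trans _ _ (ereal_sup (a @` V))).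
  by apply: ereal_inf_lbound; exists V.
apply: ge_ereal_sup => _ [n Vn <-]; apply: (le_trans (ab n)).
by apply: ereal_sup_ubound; exists n.
Qed.

Lemma limn_esup_ge (a : (\bar R)^nat) (l : \bar R) :
  (\forall n \near \oo, (l <= a n)%E) -> (l <= limn_esup a)%E.
Proof.
move=> al; rewrite leNgt; apply/negP => /limn_esup_lt h.
near \oo => n; suff : (a n < a n)%E by rewrite ltxx.
apply: (@lt_le_trans _ _ l); near: n => //.
Unshelve. all: by end_near. Qed.

Lemma covering_number_le U (r : R) dist dist' (r' : R) :
  (forall u c, dist u c < r -> dist' u c < r') ->
  (covering_number U r' dist' <= covering_number U r dist)%E.
Proof.
move=> rr'; apply: ereal_inf_le_tmp => _ [N [c cP] <-].
by exists N => //; exists c => u /cP[i]; exists i; exact: rr'.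
Qed.

Lemma covering_number_ge0 U (r : R) dist : (0 <= covering_number U r dist)%E.
Proof. by apply: le_ereal_inf_tmp => _ [N _ <-]; rewrite lee_fin. Qed.

Lemma entropy_at_nonincreasing p U (r r' : R) : r <= r' ->
  (entropy_at p U r' <= entropy_at p U r)%E.
Proof.
move=> rr'; apply: le_limn_esup => n.
rewrite lee_wpmul2l ?lee_fin ?invr_ge0//.
rewrite lee_lne ?in_itv/= ?covering_number_ge0 ?leey//.
by apply: covering_number_le => u c /lt_le_trans; exact.
Qed.

(** By monotonicity in the radius the limit is a supremum, so positivity is witnessed at a single
    radius, and vanishing bounds every radius. *)
Lemma seq_entropyE p U :
  seq_entropy p U = ereal_sup [set entropy_at p U r | r in `]0, +oo[].
Proof.
apply/cvg_lim => //; apply: (nonincreasing_at_right_cvge +oo%O) => //.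
by move=> r r' _ _; exact: entropy_at_nonincreasing.
Qed.

Lemma covering_number_sup_cover p U n (r r' : R) K : (1 <= p)%E -> 0 <= r ->
  r < r' -> sup_cover U n r K -> (covering_number U r' (dist_np n p) <= K%:R%:E)%E.
Proof.
move=> p1 r0 rr' [c cP]; apply: ereal_inf_lbound; exists K => //=.
exists c => u /cP[i iP]; exists i; apply: le_lt_trans rr'.
by apply: dist_np_le => // k kn; exact/ltW/iP.
Qed.

(** A condition on the infinite sequence rather than on a word of length [n]: one list of words of
    length [N] yields covers for all [n], and the set is measurable, so that it can be tested on a
    random path. *)
Definition blockwise N K (c : 'I_K -> nat -> R) r : set (nat -> R) :=
  [set u | forall j : nat, exists i, forall k, (k < N)%N ->
    `|u (j * N + k)%N - c i k| < r].

Lemma sup_cover_blockwise N K (c : 'I_K -> nat -> R) r n : (0 < N)%N ->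
  sup_cover (blockwise N c r) n r (K ^ (n %/ N).+1).
Proof.
move=> N0.
have -> : (K ^ (n %/ N).+1 = #|{ffun 'I_(n %/ N).+1 -> 'I_K}|)%N.
  by rewrite card_ffun !card_ord.
pose d (a : {ffun 'I_(n %/ N).+1 -> 'I_K}) (k : nat) : R :=
  c (a (inord (k %/ N))) (k %% N)%N.
apply: (@sup_cover_fin R _ d) => u /choice[a aP].
exists [ffun j : 'I_(n %/ N).+1 => a j] => k kn.
rewrite /d ffunE inordK; last by rewrite ltnS leq_div2r// ltnW.
by rewrite {1}(divn_eq k N); apply: aP; rewrite ltn_mod.
Qed.

Definition shift_closed U := forall u : nat -> R, U u -> U (fun k => u k.+1).

Lemma shift_closedD U j u : shift_closed U -> U u -> U (fun k => u (j + k)%N).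
Proof.
move=> sU Uu; elim: j => [|j /sU]//.
by under eq_fun do rewrite -addSnnS.
Qed.

Lemma sup_cover_subset U U' n r K : U `<=` U' -> sup_cover U' n r K ->
  sup_cover U n r K.
Proof. by move=> UU' [c cP]; exists c => u /UU'/cP. Qed.

Lemma sup_cover_block U N r K n : shift_closed U -> (0 < N)%N ->
  sup_cover U N r K -> sup_cover U n r (K ^ (n %/ N).+1).
Proof.
move=> sU N0 [c cP]; apply: sup_cover_subset (sup_cover_blockwise c r n N0).
move=> u Uu j; apply: (cP (fun k => u (j * N + k)%N)).
exact: (@shift_closedD U (j * N)%N u sU Uu).
Qed.

Lemma sup_cover_gt0 U n r K : U !=set0 -> sup_cover U n r K -> (0 < K)%N.
Proof. by move=> [u Uu] [c /(_ u Uu)[[i iK] _]]; apply: leq_ltn_trans iK. Qed.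

(** The definition, a limsup, only gives infinitely many [n]. Shift invariance gives all of them:
    one economical cover for words of length [N] could be concatenated into economical covers for
    all larger lengths. *)
Lemma entropy_gt0_sup_cover p U : (1 <= p)%E -> U !=set0 -> shift_closed U ->
  (0 < seq_entropy p U)%E ->
  exists2 r : R, 0 < r & exists2 h : R, 0 < h &
    forall n K, (0 < n)%N -> sup_cover U n r K -> expR (h * n%:R) < K%:R.
Proof.
move=> p1 U0 sU; rewrite seq_entropyE => /ereal_sup_gt[_ [r0 /= r00 <-] er0].
rewrite in_itv/= andbT in r00.
have [h h0 her] : exists2 h : R, 0 < h & (h%:E < entropy_at p U r0)%E.
  case: (entropy_at p U r0) er0 => [e| |]//.
    by rewrite lte_fin => e0; exists (e / 2); rewrite ?lte_fin ?divr_gt0//; lra.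
  by exists 1; rewrite ?ltry.
(* The radius is halved because [dist_np_le] turns the strict bounds into a weak one. The rate is
   halved because the [(n %/ N).+1] blocks, the last one incomplete, have total length at most
   [2 * n]. *)
exists (r0 / 2); first by rewrite divr_gt0.
exists (h / 2); first by rewrite divr_gt0.
move=> N K N0 UK; rewrite ltNge; apply/negP => KN.
have K0 := sup_cover_gt0 U0 UK.
move: her; apply/negP; rewrite -leNgt; apply: limn_esup_le.
exists N => // n /= Nn.
have n0 : (0 < n)%N by rewrite (leq_trans N0).
have n0' : 0 < n%:R :> R by rewrite ltr0n.
have h1 : (covering_number U r0 (dist_np n p) <= (K ^ (n %/ N).+1)%:R%:E)%E.
  apply: (@covering_number_sup_cover p U n (r0 / 2)) => //; [lra|lra|].
  exact: sup_cover_block.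
have KK0 : 0 < (K ^ (n %/ N).+1)%:R :> R by rewrite ltr0n expn_gt0 K0.
apply: (@le_trans _ _ (n%:R^-1%:E * lne (K ^ (n %/ N).+1)%:R%:E)%E).
  rewrite lee_wpmul2l ?lee_fin ?invr_ge0//.
  by rewrite lee_lne ?in_itv/= ?covering_number_ge0 ?leey ?lee_fin ?(ltW KK0).
rewrite lne_EFin// -EFinM lee_fin ler_pdivrMl// -[leRHS]expRK.
rewrite ler_ln ?posrE ?expR_gt0// natrX.
apply: (@le_trans _ _ (expR (h / 2 * N%:R) ^+ (n %/ N).+1)).
  by apply: lerXn2r; rewrite ?nnegrE ?expR_ge0.
rewrite -expRM_natl ler_expR.
have hN : (n %/ N).+1%:R * N%:R <= 2 * n%:R :> R.
  by rewrite -!natrM ler_nat mulSn mul2n -addnn leq_add// leq_trunc_div.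
by rewrite mulrCA; nra.
Qed.

Lemma lne_lt_natr (C : \bar R) (e : R) : (lne C < e%:E)%E -> (C < (expR e)%:E)%E.
Proof.
rewrite -lte_expeR; case: (leP C 0%E) => [C0 _|C0].
  by apply: le_lt_trans C0 _; rewrite lte_fin expR_gt0.
by rewrite lneK// in_itv/= leey ltW.
Qed.

Lemma covering_number_lt (U : set (nat -> R)) (r x : R) dist :
  (covering_number U r dist < x%:E)%E -> exists2 K : nat, K%:R < x &
   exists c : 'I_K -> nat -> R, forall u, U u -> exists i, dist u (c i) < r.
Proof.
by move=> /ereal_inf_lt[_ [K cK <-]]; rewrite lte_fin => Kx; exists K.
Qed.

(** Half of [eta] is spent on the cover in [d_{N,p}], the other half on its correction to a sup-norm
    cover. A single [N] is enough, since longer words are treated block by block. *)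
Lemma entropy0_sup_cover (M : R) p U : (1 <= p)%E ->
  (forall u k, U u -> `|u k| <= M) -> seq_entropy p U = 0%E ->
  forall r eta : R, 0 < r -> 0 < eta -> exists2 N : nat, (0 < N)%N &
    exists2 K : nat, sup_cover U N r K & K%:R <= expR (eta * N%:R).
Proof.
move=> p1 UM U0 r eta r0 e0.
have [alpha a0 aP] := @sup_cover_sparse R M r (eta / 2) r0 (divr_gt0 e0 (ltr0Sn _ _)).
have [rho rho0 rhoP] := dist_np_sparse p1 r0 a0.
have : (entropy_at p U rho < (eta / 2)%:E)%E.
  apply: (@le_lt_trans _ _ 0%E); last by rewrite lte_fin divr_gt0.
  rewrite -U0 seq_entropyE; apply: ereal_sup_ubound; exists rho => //=.
  by rewrite in_itv/= rho0.
move=> /limn_esup_lt[N0 _ /(_ N0.+1 (leqnSn _))/=].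
set N := N0.+1 => hN; exists N => //.
have N0' : 0 < N%:R :> R by rewrite ltr0n.
have /lne_lt_natr/covering_number_lt[K Ke [c cP]] :
    (lne (covering_number U rho (dist_np N p)) < (N%:R * (eta / 2))%:E)%E.
  move: hN; rewrite -(@lte_pmul2l _ N%:R%:E) ?lte_fin// muleA -!EFinM.
  by rewrite divff ?gt_eqF// mul1e.
have [|K' UK' K'e] := aP U N K c UM.
  by move=> u /cP[i iP]; exists i; exact: rhoP.
exists K' => //; apply: (le_trans K'e).
rewrite (_ : eta * N%:R = eta / 2 * N%:R + eta / 2 * N%:R); last by rewrite -mulrDl -splitr.
rewrite expRD.
by rewrite ler_pM2r ?expR_gt0// mulrC ltW.
Qed.

(** Serves the example, where sup-norm covers are the ones that can be counted. A cover in [d_{n,p}]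
    with too few centers would be corrected to a sup-norm cover with too few centers. *)
Lemma sup_cover_entropy_gt0 (M : R) p U (r h : R) : (1 <= p)%E ->
  (forall u k, U u -> `|u k| <= M) -> 0 < r -> 0 < h ->
  (forall n K, (0 < n)%N -> sup_cover U n r K -> expR (h * n%:R) <= K%:R) ->
  (0 < seq_entropy p U)%E.
Proof.
move=> p1 UM r0 h0 Uh.
have [alpha a0 aP] := @sup_cover_sparse R M r (h / 2) r0 (divr_gt0 h0 (ltr0Sn _ _)).
have [rho rho0 rhoP] := dist_np_sparse p1 r0 a0.
apply: (@lt_le_trans _ _ (h / 2)%:E); first by rewrite lte_fin divr_gt0.
apply: (@le_trans _ _ (entropy_at p U rho)); last first.
  rewrite seq_entropyE; apply: ereal_sup_ubound; exists rho => //=.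
  by rewrite in_itv/= rho0.
apply: limn_esup_ge; exists 1%N => // n /= n1.
have n0' : 0 < n%:R :> R by rewrite ltr0n.
rewrite -(@lee_pmul2l _ n%:R%:E) ?lte_fin// muleA -!EFinM divff ?gt_eqF// mul1e.
rewrite -lee_expeR lneK ?in_itv/= ?covering_number_ge0 ?leey//.
apply: le_ereal_inf_tmp => _ [K [c cP] <-]; rewrite lee_fin.
have [|K' UK' K'e] := aP U n K c UM.
  by move=> u /cP[i iP]; exists i; exact: rhoP.
have := le_trans (Uh n K' n1 UK') K'e.
rewrite (_ : h * n%:R = h / 2 * n%:R + h / 2 * n%:R); last by rewrite -mulrDl -splitr.
rewrite expRD.
by rewrite ler_pM2r ?expR_gt0// mulrC.
Qed.

(* The members of a maximal separated family are the centers of a sparse cover. *)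
Lemma separated_family (M r h : R) : 0 < r -> 0 < h ->
  exists2 kappa : R, 0 < kappa &
  forall U n, (forall u k, U u -> `|u k| <= M) ->
    (forall K, sup_cover U n r K -> expR (h * n%:R) < K%:R) ->
    exists (K : nat) (u : 'I_K -> nat -> R),
      [/\ expR (h / 2 * n%:R) <= K%:R, forall i, U (u i) &
        forall i j, i != j ->
          kappa * n%:R <= \sum_(k < n) (u i k - u j k) ^+ 2].
Proof.
move=> r0 h0.
have [alpha a0 aP] := @sup_cover_sparse R M r (h / 2) r0 (divr_gt0 h0 (ltr0Sn _ _)).
(* More than [alpha * n] coordinates differing by at least [r] already give this squared
   distance. *)
exists (alpha * r ^+ 2); first by rewrite mulr_gt0// exprn_gt0.
move=> U n UM Uh.
pose sep K (u : 'I_K -> nat -> R) := (forall i, U (u i)) /\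
  forall i j, i != j ->
          alpha * r ^+ 2 * n%:R <= \sum_(k < n) (u i k - u j k) ^+ 2.
suff [K [u [Uu sepu] hK]] : exists2 K : nat, exists u : 'I_K -> nat -> R, sep K u
    & expR (h / 2 * n%:R) <= K%:R by exists K, u.
pose m := (Num.truncn (expR (h / 2 * n%:R))).+1.
suff H : forall K, (K <= m)%N -> exists u : 'I_K -> nat -> R, sep K u.
  exists m; first exact: H.
  by rewrite ltW// truncnS_gt// ?expR_ge0.
elim=> [_|K IH Km].
  by exists (fun _ _ => 0); split => -[].
have [u [Uu sepu]] := IH (ltnW Km).
have Ke : K%:R <= expR (h / 2 * n%:R).
  by rewrite -truncn_ge_nat// expR_ge0.
(* Otherwise the family is a sparse cover with at most [expR (h / 2 * n)] centers, and its
   correction has at most [expR (h * n)], contrary to the assumption on [U]. *)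
have [v Uv vu] : exists2 v, U v & forall i : 'I_K,
    alpha * r ^+ 2 * n%:R <= \sum_(k < n) (v k - u i k) ^+ 2.
  apply: contrapT => nv.
  have [|K' UK'] := aP U n K u UM.
    move=> v Uv; apply: contrapT => nvi; apply: nv; exists v => // i.
    rewrite leNgt; apply/negP => lt_i; apply: nvi; exists i.
    rewrite -(ler_pM2r (exprn_gt0 2 r0)) mulrAC; apply: le_trans (ltW lt_i).
    rewrite mulrC mulr_natr -sumr_const.
    rewrite [leRHS](bigID (mem [pred k : 'I_n | r <= `|v k - u i k|]))/=.
    apply: ler_wpDr; first by rewrite sumr_ge0// => k _; exact: sqr_ge0.
    rewrite ler_sum// => k; rewrite inE => rk.
    by rewrite -[leRHS]real_normK ?num_real// lerXn2r// nnegrE// ltW.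
  apply/negP; rewrite -ltNge; apply: le_lt_trans (Uh K' UK').
  rewrite (_ : h * n%:R = h / 2 * n%:R + h / 2 * n%:R); last by rewrite -mulrDl -splitr.
  rewrite expRD.
  by rewrite ler_pM2r ?expR_gt0.
exists (fun i : 'I_K.+1 => if unlift ord_max i is Some j then u j else v).
split=> [i|i j]; first by case: unliftP.
case: unliftP => [i' ->|->]; case: unliftP => [j' ->|->] ij //.
- by apply: sepu; apply: contra_neq ij => ->.
- by under eq_bigr do rewrite -sqrrN opprB.
- by rewrite eqxx in ij.
Qed.

End CoverEntropy.

(** * Gaussian shifts of an i.i.d. sequence *)

Section WeightedPushforward.
Context d1 d2 (T : measurableType d1) (Y : measurableType d2) (R : realType).
Variables (mu : {measure set T -> \bar R}) (m : {measure set Y -> \bar R}).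
Variables (phi : T -> Y) (h : T -> R) (C : R).
Hypotheses (mphi : measurable_fun setT phi) (mh : measurable_fun setT h).
Hypothesis h0 : forall x, 0 <= h x.
Hypothesis hC : forall B, measurable B ->
  (\int[mu]_(x in phi @^-1` B) (h x)%:E = C%:E * m B)%E.
Local Open Scope ereal_scope.
Import HBNNSimple.

Let mhphi (g : Y -> R) : measurable_fun setT g ->
  measurable_fun [set: T] ((fun x => h x * g (phi x))%R : T -> R).
Proof.
move=> mg; apply: measurable_funM => //.
exact: measurableT_comp.
Qed.

Let hC_indic B : measurable B ->
  \int[mu]_x (h x * \1_B (phi x))%:E = C%:E * m B.
Proof.
move=> mB; rewrite -hC// [RHS]integral_mkcond; apply: eq_integral => x _.
rewrite /patch indicE (_ : (x \in _) = (phi x \in B)); last first.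
  by apply/idP/idP; rewrite !inE.
by case: ifP => _; rewrite ?mulr1 ?mulr0.
Qed.

Lemma integral_weighted_nnsfun (f : {nnsfun Y >-> R}) :
  \int[mu]_x (h x * f (phi x))%:E = C%:E * \int[m]_y (f y)%:E.
Proof.
under [in RHS]eq_integral do rewrite fimfunE -fsumEFin//.
rewrite [in RHS]ge0_integral_fsum//; last 2 first.
  - by move=> y; exact/measurable_EFinP/measurable_funM.
  - by move=> y x _; rewrite nnfun_muleindic_ge0.
rewrite ge0_mule_fsumr; last first.
  by move=> y; apply: integral_ge0 => x _; rewrite nnfun_muleindic_ge0.
under [in LHS]eq_integral => x _.
  rewrite EFinM fimfunE -fsumEFin// ge0_mule_fsumr; last first.
    by move=> r; rewrite nnfun_muleindic_ge0.
  over.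
rewrite ge0_integral_fsum//; last 2 first.
  - move=> r; under eq_fun do rewrite -EFinM.
    apply/measurable_EFinP.
    have mf : measurable_fun setT (fun y => r * \1_(f @^-1` [set r]) y)%R.
      by apply: measurable_funM => //.
    exact: (mhphi mf).
  - move=> r x _; apply: mule_ge0; first by rewrite lee_fin.
    exact: nnfun_muleindic_ge0.
apply: eq_fsbigr => r; rewrite inE => -[y _ fy].
have r0 : (0 <= r)%R by rewrite -fy.
rewrite integralZl_indic_nnsfun// integral_indic// setIT muleCA -hC_indic//.
rewrite -ge0_integralZl//=; last 2 first.
- by apply/measurable_EFinP; apply: (mhphi (g := \1_(f @^-1` [set r]))).
- by move=> x _; rewrite lee_fin mulr_ge0.
by apply: eq_integral => x _; rewrite -!EFinM mulrCA.
Qed.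

(** From sets to functions, by monotone approximation. It serves twice: with [phi] the identity and
    [h] the normal density it unfolds integrals against [normal_prob]; with [phi] one noise variable
    and [h] a product over the others it expresses independence. *)
Lemma integral_weighted (g : Y -> R) : measurable_fun setT g ->
  (forall y, 0 <= g y)%R ->
  \int[mu]_x (h x * g (phi x))%:E = C%:E * \int[m]_y (g y)%:E.
Proof.
move=> mg g0.
have mg' : measurable_fun setT (EFin \o g) by exact/measurable_EFinP.
pose f_ := nnsfun_approx measurableT mg'.
have gE : \int[m]_y (g y)%:E = limn (fun n => \int[m]_y (f_ n y)%:E).
  rewrite -monotone_convergence//.
  - apply: eq_integral => y _; apply/esym/cvg_lim => //.
    by apply: cvg_nnsfun_approx=> // *; rewrite lee_fin.
  - by move=> n; exact/measurable_EFinP/measurable_funP.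
  - by move=> n y _; rewrite lee_fin.
  - by move=> y _ p q pq; rewrite lee_fin; exact/lefP/nd_nnsfun_approx.
rewrite gE -limeMl//; last first.
  apply/ereal_nondecreasing_is_cvgn => p q pq; apply: ge0_le_integral => //=.
  - by move=> y _; rewrite lee_fin.
  - exact/measurable_EFinP.
  - exact/measurable_EFinP.
  - by move=> y _; rewrite lee_fin; exact/lefP/nd_nnsfun_approx.
rewrite [X in _ = limn X](_ : _ =
    fun n => \int[mu]_x (h x * f_ n (phi x))%:E); last first.
  by apply/funext => n; rewrite integral_weighted_nnsfun.
rewrite -monotone_convergence//.
- apply: eq_integral => x _; apply/esym/cvg_lim => //=.
  under eq_fun do rewrite EFinM.
  rewrite EFinM; apply: cvgeZl => //.
  by apply: cvg_nnsfun_approx => // *; rewrite lee_fin.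
- by move=> n; apply/measurable_EFinP; apply: mhphi; exact: measurable_funP.
- by move=> n x _; rewrite lee_fin mulr_ge0.
- move=> x _ p q pq; rewrite lee_fin ler_wpM2l//.
  exact/lefP/nd_nnsfun_approx.
Qed.

End WeightedPushforward.

Section GaussianShift.
Context {R : realType}.
Implicit Types (s a z : R).
Notation mu := (@lebesgue_measure R).

Lemma lebesgue_measureD a (A : set R) : measurable A ->
  pushforward mu (fun x : measurableTypeR R => x + a : measurableTypeR R) A = mu A.
Proof.
move=> mA.
have mf : measurable_fun setT (fun x : measurableTypeR R => x + a : measurableTypeR R).
  exact: measurable_funD.
apply/esym/lebesgue_measure_unique => //= _ [[b c]] _ <-.
rewrite /pushforward.
rewrite (_ : _ @^-1` _ = `]b - a, c - a]%classic); last first.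
  by apply/seteqP; split => x /=; rewrite !in_itv/= ltrBlDr lerBrDr.
by rewrite !lebesgue_measure_itv/= !lte_fin ltrD2r -!EFinB opprB addrA subrK.
Qed.
End GaussianShift.

Section TiltedGaussian.
Context {R : realType}.
Implicit Types (s a z : R).
Notation mu := (@lebesgue_measure R).

(** The density of the normal law with mean [a] and standard deviation [s] with respect to the
    centered one. *)
Definition gauss_tilt s a z : R := expR ((a * z - a ^+ 2 / 2) / s ^+ 2).

Lemma measurable_gauss_tilt s a : measurable_fun setT (gauss_tilt s a).
Proof.
apply: measurableT_comp => //; apply: measurable_funM => //.
by apply: measurable_funB => //; exact: measurable_funM.
Qed.

Lemma normal_pdf_tilt s a z : s != 0 ->
  normal_pdf 0 s z * gauss_tilt s a z = normal_pdf 0 s (z - a).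
Proof.
move=> s0; rewrite !normal_pdfE// -mulrA; congr (_ * _).
rewrite /normal_fun /gauss_tilt -expRD; congr expR.
by rewrite -mulr_natr; field.
Qed.

(** Cameron-Martin in dimension one: the tilt translates the density, and translation invariance of
    Lebesgue measure moves the translation to the set. *)
Lemma integral_gauss_tilt s a (B : set R) : s != 0 -> measurable B ->
  (\int[normal_prob 0 s]_z (\1_B z * gauss_tilt s a z)%R%:E =
   normal_prob 0 s [set z | B (z + a)%R])%E.
Proof.
move=> s0 mB.
have mg : measurable_fun setT (fun z : measurableTypeR R => \1_B z * gauss_tilt s a z).
  by apply: measurable_funM => //; exact: measurable_gauss_tilt.
have mpdf : measurable_fun setT (normal_pdf 0 s : R -> R) by exact: measurable_normal_pdf.
have hC A : measurable A ->
    (\int[mu]_(x in id @^-1` A) (normal_pdf 0 s x)%:E = 1%:E * normal_prob 0 s A)%E.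
  by move=> mA; rewrite mul1e.
have g0 z : 0 <= \1_B z * gauss_tilt s a z by rewrite mulr_ge0// expR_ge0.
have := @integral_weighted _ _ _ _ _ mu (normal_prob 0 s) id (normal_pdf 0 s) 1
  (@measurable_id _ _ _) mpdf (normal_pdf_ge0 0 s) hC _ mg g0.
rewrite mul1e => <-.
have mD : measurable_fun setT (fun x : measurableTypeR R => x + a : measurableTypeR R).
  exact: measurable_funD.
have mB' : measurable_fun setT (fun z : measurableTypeR R => (normal_pdf 0 s (z - a))%:E).
  apply/measurable_EFinP; apply: (measurableT_comp (f := normal_pdf 0 s)) => //.
  exact: measurable_funB.
transitivity (\int[mu]_(z in B) (normal_pdf 0 s (z - a)%R)%:E)%E.
  rewrite [RHS]integral_mkcond; apply: eq_integral => z _ /=.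
  rewrite /patch indicE; case: ifP => _; rewrite ?mul0r ?mulr0//.
  by rewrite mul1r normal_pdf_tilt.
rewrite /normal_prob.
transitivity (\int[mu]_(x in (fun x : measurableTypeR R => x + a : measurableTypeR R)%R @^-1` B)
  ((fun z : R => (normal_pdf 0 s (z - a)%R)%:E) \o (fun x : R => x + a)%R) x)%E; last first.
  by apply: eq_integral => x _ /=; rewrite addrK.
rewrite -(ge0_integral_pushforward mD)//; last 2 first.
- exact/measurable_funTS.
- by move=> z _; rewrite lee_fin normal_pdf_ge0.
by apply: eq_measure_integral => A mA _; exact/esym/lebesgue_measureD.
Qed.

End TiltedGaussian.

(** * Measures on the space of sequences *)

Section SeqSpace.
Context {R : realType}.

Lemma measurable_coord k : measurable_fun setT (fun z : seq_space R => z k).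
Proof.
move=> _ B mB; rewrite setTI; apply: sub_sigma_algebra.
by exists k, B.
Qed.

Lemma measurable_to_seq_space d (T : measurableType d) (g : T -> seq_space R) :
  (forall k, measurable_fun setT (fun w => g w k)) -> measurable_fun setT g.
Proof.
move=> mg; apply: (@measurability _ _ T (seq_space R) setT g (@cylinders R)) => //.
move=> _ [_ [k [B [mB ->]]] <-].
exact: mg.
Qed.

Definition rectangle (n : nat) (B : nat -> set R) : set (seq_space R) :=
  [set z | forall k, (k < n)%N -> B k (z k)].

(** Cylinders over one coordinate generate the sigma-algebra but are not closed under intersection;
    rectangles are, as uniqueness of measures requires. *)
Definition rectangles : set (set (seq_space R)) :=
  [set A | exists n B, (forall k, measurable (B k)) /\ A = rectangle n B].

Lemma measurable_rectangle n B : (forall k, measurable (B k)) ->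
  measurable (rectangle n B).
Proof.
move=> mB; rewrite (_ : rectangle n B =
  \bigcap_(k < n) ((fun z : seq_space R => z k) @^-1` B k)).
  apply: bigcap_measurableType => k _.
  by rewrite -[X in measurable X]setTI; exact: measurable_coord.
by apply/seteqP; split=> z.
Qed.

Lemma seq_space_rectangles :
  @measurable _ (seq_space R) = <<s rectangles >>.
Proof.
apply/seteqP; split.
  apply: smallest_sub; first exact: smallest_sigma_algebra.
  move=> _ [k [B [mB ->]]]; apply: sub_sigma_algebra.
  exists k.+1, (fun j => if j == k then B else setT); split.
    by move=> j; case: ifP.
  apply/seteqP; split=> z /= h.
    by move=> j _; case: eqP => // ->.
  by have := h k (ltnSn _); rewrite eqxx.
apply: smallest_sub; first exact: sigma_algebra_measurable.
by move=> _ [n [B [mB ->]]]; exact: measurable_rectangle.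
Qed.

Lemma setI_closed_rectangles : setI_closed rectangles.
Proof.
move=> _ _ [n1 [B1 [mB1 ->]]] [n2 [B2 [mB2 ->]]].
exists (maxn n1 n2), (fun k => (if (k < n1)%N then B1 k else setT) `&`
                           (if (k < n2)%N then B2 k else setT)); split.
  by move=> k; apply: measurableI; case: ifP.
apply/seteqP; split=> z /=.
  by move=> [h1 h2] k _; split; case: ifP => //; [exact: h1|exact: h2].
move=> h; split=> k kn.
  by have [] := h k (leq_trans kn (leq_maxl _ _)); rewrite kn.
by have [] := h k (leq_trans kn (leq_maxr _ _)); rewrite kn.
Qed.

Lemma seq_space_measure_unique (m1 m2 : {measure set (seq_space R) -> \bar R}) :
  (m1 setT < +oo)%E ->
  (forall n B, (forall k, measurable (B k)) ->
    m1 (rectangle n B) = m2 (rectangle n B)) ->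
  forall A, measurable A -> m1 A = m2 A.
Proof.
move=> m1oo m12 A mA.
apply: (measure_unique rectangles (fun=> setT)) => //.
- exact: seq_space_rectangles.
- exact: setI_closed_rectangles.
- move=> _; exists 0%N, (fun=> setT); split => //.
  by apply/seteqP; split.
- by rewrite bigcup_const.
- by move=> _ [n [B [mB ->]]]; exact: m12.
Qed.

End SeqSpace.

Section WeightedDistribution.
Context d1 d2 (T : measurableType d1) (Y : measurableType d2) (R : realType).
Variables (mu : {measure set T -> \bar R}) (phi : T -> Y) (h : T -> \bar R).
Local Open Scope ereal_scope.

(** The image under [phi] of the measure with density [h]. The proofs are arguments so that the
    measure structure can be attached to the constant. *)
Definition weighted_distribution (mphi : measurable_fun setT phi)
    (mh : measurable_fun setT h) (h0 : forall x, 0 <= h x) (A : set Y) :=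
  \int[mu]_(x in phi @^-1` A) h x.

Hypotheses (mphi : measurable_fun setT phi) (mh : measurable_fun setT h).
Hypothesis h0 : forall x, 0 <= h x.
Local Notation nu := (weighted_distribution mphi mh h0).

Let nu0 : nu set0 = 0.
Proof. by rewrite /nu preimage_set0 integral_set0. Qed.

Let nu_ge0 A : 0 <= nu A.
Proof. exact: integral_ge0. Qed.

Let nu_sigma_additive : semi_sigma_additive nu.
Proof.
move=> F mF tF mUF; rewrite /nu preimage_bigcup.
apply: semi_sigma_additive_nng_induced => //.
- by move=> n; rewrite -[X in measurable X]setTI; exact: mphi.
- apply/trivIsetP => /= i j _ _ ij; rewrite -preimage_setI.
  by move/trivIsetP : tF => /(_ _ _ _ _ ij) ->//; rewrite preimage_set0.
- by rewrite -preimage_bigcup -[X in measurable X]setTI; exact: mphi.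
Qed.

HB.instance Definition _ := isMeasure.Build _ _ _ nu nu0 nu_ge0 nu_sigma_additive.

End WeightedDistribution.

(** * The Cameron-Martin formula for finitely many shifted coordinates *)

Section IidShift.
Context {R : realType} d (Omega : measurableType d) (P : probability Omega R).
Variables (eps : nat -> {RV P >-> R}) (s : R).
Hypothesis iid : iid_centered_normal eps s.
Local Notation gam := (normal_prob (0 : R) s).

Lemma normal_prob_fin_num (B : set R) : measurable B -> gam B \is a fin_num.
Proof.
move=> mB.
exact: (fin_num_measure (normal_prob 0 s : probability (measurableTypeR R) R)).
Qed.

Lemma iid_distribution k (A : set R) : measurable A ->
  P (eps k @^-1` A) = gam A.
Proof. by move=> mA; have [_ h] := iid; exact: h. Qed.

Lemma measurable_path_of : measurable_fun setT (path_of eps).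
Proof.
apply: measurable_to_seq_space => k.
exact: (measurable_funP (eps k)).
Qed.

Lemma iid_rectangle m (B : nat -> set R) : (forall k, measurable (B k)) ->
  P [set w | forall k, (k < m)%N -> B k (eps k w)] = (\prod_(k < m) fine (gam (B k)))%:E.
Proof.
move=> mB.
rewrite (_ : [set w | _] = \bigcap_(k in [set` iota 0 m]) (eps k @^-1` B k)).
  have [h _] := iid; rewrite h ?iota_uniq//.
  rewrite -(big_mkord xpredT (fun k => fine (gam (B k)))) /index_iota subn0.
  rewrite (big_morph EFin (@EFinM R) (erefl 1%:E)); apply: eq_bigr => k _.
  rewrite iid_distribution// fineK//. exact: normal_prob_fin_num.
by apply/seteqP; split=> w h k /=; [rewrite mem_iota add0n; exact: h|
  move=> km; apply: h; rewrite /= mem_iota].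
Qed.

(** Independence is known for sets only, so the indicators are replaced by functions one coordinate
    at a time: [j] counts the coordinates already treated. The statement mixes both kinds of
    factors, for all [B], because the step varies the set at coordinate [j]. *)
Lemma iid_expectation_prod_aux m j (B : nat -> set R) (f : nat -> R -> R) (F : nat -> R) :
  (j <= m)%N -> (forall k, measurable (B k)) ->
  (forall k, measurable_fun setT (f k)) -> (forall k x, 0 <= f k x) ->
  (forall k, (\int[gam]_x (f k x)%:E = (F k)%:E)%E) ->
  (\int[P]_w (\prod_(k < m) (if (k < j)%N then f k else \1_(B k)) (eps k w))%:E
   = (\prod_(k < m) (if (k < j)%N then F k else fine (gam (B k))))%:E)%E.
Proof.
elim: j B => [|j IH] B jm mB mf f0 fF.
  rewrite -iid_rectangle//.
  transitivity (\int[P]_w (\1_[set w | forall k, (k < m)%N -> B k (eps k w)] w)%:E)%E.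
    apply: eq_integral => w _; congr EFin; rewrite indicE.
    case: (boolP (w \in _)) => wB.
      rewrite big1// => k _; rewrite indicE mem_set//.
      by move: wB; rewrite inE; apply.
    apply/eqP; rewrite prodf_seq_eq0; apply: contraNT wB => /hasPn h.
    rewrite inE => k km; have := h (Ordinal km) (mem_index_enum _).
    by rewrite /= indicE pnatr_eq0 eqb0 negbK inE.
  rewrite integral_indic ?setIT//.
  rewrite (_ : [set w | _] = path_of eps @^-1` rectangle m B)//.
  rewrite -[X in measurable X]setTI; apply: measurable_path_of => //.
  exact: measurable_rectangle.
pose jo := Ordinal jm.
pose H w := \prod_(k < m | k != jo) (if (k < j)%N then f k else \1_(B k)) (eps k w).
pose C := \prod_(k < m | k != jo) (if (k < j)%N then F k else fine (gam (B k))).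
have mg k : measurable_fun setT (if (k < j)%N then f k else \1_(B k)).
  by case: ifP.
have mH : measurable_fun setT H.
  rewrite /H; under eq_fun do rewrite big_mkcond.
  apply: measurable_prod => k _; case: (k != jo) => //.
  exact: (measurableT_comp (mg k) (measurable_funP (eps k))).
have H0 w : 0 <= H w.
  by rewrite prodr_ge0// => k _; case: ifP.
have hC A : measurable A ->
    (\int[P]_(w in eps j @^-1` A) (H w)%:E = C%:E * gam A)%E.
  (* Varying the [j]-th set turns the induction hypothesis into the assumption of
     [integral_weighted], the product over the other coordinates being the weight. *)
  move=> mA; pose B' k := if k == j then A else B k.
  have mB' k : measurable (B' k) by rewrite /B'; case: ifP.
  have := IH B' (ltnW jm) mB' mf f0 fF.
  rewrite [in X in _ = X -> _](bigD1 jo)//= ltnn /B' eqxx.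
  rewrite EFinM fineK ?normal_prob_fin_num// muleC.
  rewrite [X in (_ = X%:E * _)%E -> _](_ : _ = C); last first.
    by apply: eq_bigr => k kj; rewrite -val_eqE/= in kj; rewrite (negbTE kj).
  move=> <-; rewrite integral_mkcond; apply: eq_integral => w _.
  rewrite (bigD1 jo)//= ltnn eqxx /patch indicE.
  rewrite (_ : (w \in _) = (eps j w \in A)); last by apply/idP/idP; rewrite !inE.
  case: ifP => _; rewrite ?mul0r// mul1r; congr EFin.
  by apply: eq_bigr => k kj; rewrite -val_eqE/= in kj; rewrite (negbTE kj).
have := @integral_weighted _ _ Omega (measurableTypeR R) R P (normal_prob 0 s)
  (eps j) H C (measurable_funP (eps j)) mH H0 hC (f j) (mf j) (f0 j).
rewrite fF -EFinM => E.
transitivity (\int[P]_w (H w * f j (eps j w))%:E)%E.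
  apply: eq_integral => w _; congr EFin.
  rewrite (bigD1 jo)//= ltnSn mulrC; congr (_ * _).
  apply: eq_bigr => k kj; rewrite -val_eqE/= in kj.
  by have -> : (k < j.+1)%N = (k < j)%N by rewrite ltnS leq_eqVlt (negbTE kj).
rewrite E; congr EFin; rewrite [RHS](bigD1 jo)//= ltnSn mulrC; congr (_ * _).
apply: eq_bigr => k kj; rewrite -val_eqE/= in kj.
by have -> : (k < j.+1)%N = (k < j)%N by rewrite ltnS leq_eqVlt (negbTE kj).
Qed.

Lemma iid_expectation_prod m (f : nat -> R -> R) (F : nat -> R) :
  (forall k, measurable_fun setT (f k)) -> (forall k x, 0 <= f k x) ->
  (forall k, (\int[gam]_x (f k x)%:E = (F k)%:E)%E) ->
  (\int[P]_w (\prod_(k < m) f k (eps k w))%:E = (\prod_(k < m) F k)%:E)%E.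
Proof.
move=> mf f0 fF.
transitivity (\int[P]_w (\prod_(k < m)
    (if (k < m)%N then f k else \1_set0) (eps k w))%:E)%E.
  apply: eq_integral => w _; congr EFin; apply: eq_bigr => k _.
  by rewrite ltn_ord.
rewrite (@iid_expectation_prod_aux m m (fun=> set0) f F)//.
by congr EFin; apply: eq_bigr => k _; rewrite ltn_ord.
Qed.

Hypothesis s0 : s != 0.

Definition path_tilt (n : nat) (a : nat -> R) (w : Omega) : R :=
  \prod_(k < n) gauss_tilt s (a k) (eps k w).

Lemma measurable_path_tilt n a : measurable_fun setT (path_tilt n a).
Proof.
apply: measurable_prod => k _.
by apply: measurableT_comp => //; exact: measurable_gauss_tilt.
Qed.

Lemma path_tilt_ge0 n a w : 0 <= path_tilt n a w.
Proof. by rewrite prodr_ge0// => k _; exact: expR_ge0. Qed.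

Definition shifted_path (n : nat) (a : nat -> R) (w : Omega) : seq_space R :=
  fun k => if (k < n)%N then eps k w + a k else eps k w.

Lemma measurable_shifted_path n a : measurable_fun setT (shifted_path n a).
Proof.
apply: measurable_to_seq_space => k; rewrite /shifted_path.
by case: (k < n)%N => //; exact: measurable_funD.
Qed.

(** On rectangles this is the product of the one-dimensional formulas; both sides are measures in
    [A], hence agree everywhere. *)
Lemma path_shift n a (A : set (seq_space R)) : measurable A ->
  (P (shifted_path n a @^-1` A) =
   \int[P]_(w in path_of eps @^-1` A) (path_tilt n a w)%:E)%E.
Proof.
have mt : measurable_fun setT (fun w => (path_tilt n a w)%:E).
  by apply/measurable_EFinP; exact: measurable_path_tilt.
have t0 w : (0 <= (path_tilt n a w)%:E)%E by rewrite lee_fin path_tilt_ge0.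
pose X : {mfun Omega >-> seq_space R} :=
  HB.pack (shifted_path n a) (isMeasurableFun.Build _ _ _ _ _ (measurable_shifted_path n a)).
pose m1 : {measure set (seq_space R) -> \bar R} := distribution P X.
pose m2 : {measure set (seq_space R) -> \bar R} :=
  weighted_distribution P measurable_path_of mt t0.
suff m12 : forall m B, (forall k, measurable (B k)) ->
    m1 (rectangle m B) = m2 (rectangle m B).
  move=> mA; apply: (@seq_space_measure_unique R m1 m2) => //.
  rewrite /m1/= /pushforward.
  by rewrite (le_lt_trans (probability_le1 _ _))// ?ltry.
move=> m B0 mB0.
pose a' k := if (k < n)%N then a k else 0.
(* The rectangle and the tilt are brought to a common length: beyond [m] the sets are full, and
   beyond [n] the shift [a'] is 0 and its tilt is 1. *)
pose M := maxn m n; pose B k := if (k < m)%N then B0 k else setT.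
have mB k : measurable (B k) by rewrite /B; case: ifP.
have -> : rectangle m B0 = rectangle M B.
  apply/seteqP; split=> z /= h k; rewrite /B.
    by case: ifP => // km _; exact: h.
  by move=> km; have := h k (leq_trans km (leq_maxl _ _)); rewrite /B km.
pose B' k := [set z | B k (z + a' k)].
have mB' k : measurable (B' k).
  have mD : measurable_fun setT (fun z : R => z + a' k) by exact: measurable_funD.
  by rewrite -[X in measurable X]setTI; exact: mD.
have -> : m1 (rectangle M B) = (\prod_(k < M) fine (gam (B' k)))%:E.
  rewrite -iid_rectangle//; congr (P _).
  apply/seteqP; split=> w h k /h; rewrite /B' /a' /= /shifted_path;
    by case: ifP; rewrite ?addr0.
rewrite -(@iid_expectation_prod M (fun k z => \1_(B k) z * gauss_tilt s (a' k) z)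
  (fun k => fine (gam (B' k)))); last 3 first.
- by move=> k; apply: measurable_funM => //; exact: measurable_gauss_tilt.
- by move=> k x; rewrite mulr_ge0// expR_ge0.
- by move=> k; rewrite integral_gauss_tilt// fineK// normal_prob_fin_num.
rewrite /m2 /= /weighted_distribution integral_mkcond; apply: eq_integral => w _.
rewrite /patch; case: ifPn => wM.
  congr EFin; rewrite /path_tilt (big_ord_widen M (fun k => gauss_tilt s (a k) (eps k w))) ?leq_maxr//.
  rewrite [RHS]big_mkcond; apply: eq_bigr => k _.
  rewrite indicE mem_set; last first.
    by move: wM; rewrite inE => /(_ k (ltn_ord k)).
  rewrite mul1r /a'; case: ifP => // _.
  by rewrite /gauss_tilt mul0r expr0n/= mul0r subr0 mul0r expR0.
congr EFin; apply/eqP; rewrite prodf_seq_eq0.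
apply: contraNT wM => /hasPn h.
rewrite inE => k kM; have := h (Ordinal kM) (mem_index_enum _).
by rewrite /= mulf_eq0 negb_or => /andP[]; rewrite indicE pnatr_eq0 eqb0 negbK inE.
Qed.

End IidShift.

(** * Correlation with Gaussian noise *)

Definition dot (R : realType) (n : nat) (c z : nat -> R) : R :=
  \sum_(k < n) c k * z k.

Section DotProduct.
Context {R : realType}.
Implicit Types (n : nat) (u v c z : nat -> R).

Lemma measurable_dot n c : measurable_fun setT (dot n c : seq_space R -> R).
Proof.
apply: measurable_sum => k; apply: measurable_funM => //.
exact: measurable_coord.
Qed.

Lemma dotC n u v : dot n u v = dot n v u.
Proof. by apply: eq_bigr => k _; rewrite mulrC. Qed.

Lemma dotZr n (x : R) u v : dot n u (fun k => x * v k) = x * dot n u v.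
Proof. by rewrite mulr_sumr; apply: eq_bigr => k _; rewrite mulrCA. Qed.

Lemma dotZl n (x : R) u v : dot n (fun k => x * u k) v = x * dot n u v.
Proof. by rewrite dotC dotZr dotC. Qed.

Lemma dotBr n u v z : dot n u (fun k => v k - z k) = dot n u v - dot n u z.
Proof. by rewrite -sumrB; apply: eq_bigr => k _; rewrite mulrBr. Qed.

Lemma dotBl n u v z : dot n (fun k => u k - v k) z = dot n u z - dot n v z.
Proof. by rewrite dotC dotBr !(dotC _ z). Qed.

Lemma dotNl n u z : dot n (fun k => - u k) z = - dot n u z.
Proof. by rewrite -sumrN; apply: eq_bigr => k _; rewrite mulNr. Qed.

Lemma dotxx_ge0 n u : 0 <= dot n u u.
Proof. by rewrite sumr_ge0// => k _; rewrite -expr2 sqr_ge0. Qed.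

Lemma dotxx_le n u (M : R) : (forall k, (k < n)%N -> `|u k| <= M) ->
  dot n u u <= M ^+ 2 * n%:R.
Proof.
move=> uM; rewrite mulr_natr -[X in _ *+ X]card_ord -sumr_const ler_sum// => k _.
rewrite -expr2 -[leLHS]real_normK ?num_real// lerXn2r ?nnegrE//.
  by rewrite (le_trans _ (uM k _)).
exact: uM.
Qed.

End DotProduct.

Section BorelCantelli.
Context d (T : measurableType d) {R : realType} (P : {measure set T -> \bar R}).

Lemma borel_cantelli_exp (E : nat -> set T) (C alpha : R) N : 0 <= C -> 0 < alpha ->
  (forall n, measurable (E n)) ->
  (forall n, (N <= n)%N -> (P (E n) <= (C * expR (- (alpha * n%:R)))%:E)%E) ->
  {ae P, forall w, \forall n \near \oo, ~ E n w}.
Proof.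
move=> C0 a0 mE PE.
(* Emptying the first [N] events makes the geometric bound valid from index 0 without changing what
   happens eventually. *)
pose F n := if (N <= n)%N then E n else set0.
have mF n : measurable (F n) by rewrite /F; case: ifP.
pose r := expR (- alpha).
have r0 : 0 < r by exact: expR_gt0.
have r1 : `|r| < 1 by rewrite gtr0_norm// /r -[ltRHS]expR0 ltr_expR oppr_lt0.
have PF n : (P (F n) <= (C * r ^+ n)%:E)%E.
  rewrite /F; case: ifPn => [/PE|_].
    by rewrite -mulNr -expRM_natr.
  by rewrite measure0 lee_fin mulr_ge0// exprn_ge0// ltW.
have F0 : P (lim_sup_set F) = 0%E.
  apply: lim_sup_set_cvg0 => //.
  apply: (@le_lt_trans _ _ (C * (1 - r)^-1)%:E); last by rewrite ltry.
  apply: lime_le; first by apply: is_cvg_nneseries.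
  apply: nearW => n.
  apply: (@le_trans _ _ (\sum_(0 <= i < n) (C * r ^+ i)%:E)%E).
    by apply: lee_sum => i _.
  by rewrite sumEFin lee_fin; exact: geometric_le_lim.
have mL : measurable (lim_sup_set F).
  apply: bigcap_measurableType => n _; apply: bigcup_measurable => k _; exact: mF.
apply: (negligibleS _ ((negligibleP P mL).2 F0)) => w nw m _.
apply: contrapT => h; apply: nw; exists (maxn m N) => // k /= mk Ekw.
apply: h; exists k => /=; first exact: leq_trans (leq_maxl _ _) mk.
by rewrite /F (leq_trans (leq_maxr _ _) mk).
Qed.

End BorelCantelli.

Section GaussianDeviation.
Context {R : realType} d (Omega : measurableType d) (P : probability Omega R).
Variables (eps : nat -> {RV P >-> R}) (s : R).
Hypotheses (iid : iid_centered_normal eps s) (s0 : 0 < s).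
Local Notation path := (path_of eps).

Let s_neq0 : s != 0. Proof. by rewrite gt_eqF. Qed.

Lemma measurable_pre_path (A : set (seq_space R)) : measurable A ->
  measurable (path @^-1` A).
Proof.
by move=> mA; rewrite -[X in measurable X]setTI; exact: measurable_path_of.
Qed.

Lemma path_tiltE n a w : path_tilt eps s n a w =
  expR ((dot n a (path w) - dot n a a / 2) / s ^+ 2).
Proof.
rewrite /path_tilt /gauss_tilt -expR_sum; congr expR.
rewrite -mulr_suml; congr (_ / _); rewrite sumrB; congr (_ - _).
by rewrite /dot -mulr_suml; congr (_ / _); apply: eq_bigr => k _; rewrite expr2.
Qed.

Let mtilt n a : measurable_fun setT (fun w => (path_tilt eps s n a w)%:E).
Proof. by apply/measurable_EFinP; exact: measurable_path_tilt. Qed.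

(** The integral of the density over the event is the probability that the shifted path lies in [A],
    hence at most 1. With a density that is large on [A] this is a Chernoff bound. *)
Lemma path_shift_ge n a (A : set (seq_space R)) (c : R) : measurable A -> 0 <= c ->
  (forall w, A (path w) -> c <= path_tilt eps s n a w) ->
  (c%:E * P (path @^-1` A) <= 1)%E.
Proof.
move=> mA c0 cA; have mA' := measurable_pre_path mA.
apply: (@le_trans _ _ (P (shifted_path eps n a @^-1` A))).
  rewrite (path_shift iid s_neq0)// -integral_cst//.
  by apply: ge0_le_integral => //; exact/measurable_funTS.
apply: probability_le1.
by rewrite -[X in measurable X]setTI; exact: measurable_shifted_path.
Qed.

Lemma path_shift_le n a (A : set (seq_space R)) (c : R) : measurable A -> 0 <= c ->
  (forall w, A (path w) -> path_tilt eps s n a w <= c) ->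
  (P (shifted_path eps n a @^-1` A) <= c%:E * P (path @^-1` A))%E.
Proof.
move=> mA c0 cA; have mA' := measurable_pre_path mA.
rewrite (path_shift iid s_neq0)// -integral_cst//.
apply: ge0_le_integral => //; last exact/measurable_funTS.
by move=> w _; rewrite lee_fin path_tilt_ge0.
Qed.

Lemma dot_deviation n c (M t : R) : 0 < M -> 0 <= t ->
  (forall k, (k < n)%N -> `|c k| <= M) ->
  (P [set w | t * n%:R <= dot n c (path w)]%R
    <= (expR (- (t ^+ 2 / (2 * M ^+ 2 * s ^+ 2) * n%:R)))%:E)%E.
Proof.
move=> M0 t0 cM.
pose A : set (seq_space R) := [set z | t * n%:R <= dot n c z].
have mA : measurable A.
  have := @measurable_dot R n c measurableT `[t * n%:R, +oo[%classic (measurable_itv _).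
  rewrite setTI; congr measurable.
  by apply/seteqP; split=> z; rewrite /A /= in_itv/= andbT.
(* The maximizer of [l * t - l ^+ 2 * M ^+ 2 / 2], which is [s ^+ 2] times the rate obtained from
   the shift [l * c]. *)
pose l := t / M ^+ 2.
have := @path_shift_ge n (fun k => l * c k) A
  (expR (t ^+ 2 / (2 * M ^+ 2 * s ^+ 2) * n%:R)) mA (expR_ge0 _).
have -> : [set w | t * n%:R <= dot n c (path w)] = path @^-1` A by [].
move=> h; rewrite expRN -[leRHS]mul1e.
have /h {h} : forall w, A (path w) -> expR (t ^+ 2 / (2 * M ^+ 2 * s ^+ 2) * n%:R) <=
      path_tilt eps s n (fun k => l * c k) w.
  move=> w; rewrite /A/= => Aw; rewrite path_tiltE ler_expR.
  rewrite dotZl dotZl dotZr.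
  have cc := dotxx_le cM.
  rewrite ler_pdivlMr ?exprn_gt0//.
  have l0 : 0 <= l by rewrite divr_ge0// sqr_ge0.
  have -> : t ^+ 2 / (2 * M ^+ 2 * s ^+ 2) * n%:R * s ^+ 2 =
     l * (t * n%:R) - l * (l * (M ^+ 2 * n%:R)) / 2.
    by rewrite /l; field; rewrite s_neq0 gt_eqF.
  have h1 : l * (t * n%:R) <= l * dot n c (path w) by rewrite ler_wpM2l.
  have h2 : l * (l * dot n c c) <= l * (l * (M ^+ 2 * n%:R)).
    by rewrite !ler_wpM2l.
  lra.
have pf : P (path @^-1` A) \is a fin_num.
  by apply: fin_num_measure; exact: measurable_pre_path.
rewrite -(fineK pf) -EFinM mul1e !lee_fin => h.
by rewrite -[leRHS]mul1r ler_pdivlMr ?expR_gt0// mulrC.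
Qed.

End GaussianDeviation.

(** * Separated orbits as a code for the Gaussian channel *)

Section SeparatedFamily.
Context {R : realType} d (Omega : measurableType d) (P : probability Omega R).
Variables (eps : nat -> {RV P >-> R}) (s : R).
Hypotheses (iid : iid_centered_normal eps s) (s0 : 0 < s).
Local Notation path := (path_of eps).
Variables (kappa M h l : R).
Hypotheses (kappa0 : 0 < kappa) (M0 : 0 < M) (h0 : 0 < h) (l0 : 0 < l).
Hypothesis lh : l ^+ 2 * (kappa / 4 + M ^+ 2 / 2) <= h / 2.
Variables (n K : nat) (u : 'I_K -> nat -> R).
Hypothesis uM : forall i k, (k < n)%N -> `|u i k| <= M.
Hypothesis usep : forall i j, i != j ->
  kappa * n%:R <= \sum_(k < n) (u i k - u j k) ^+ 2.
Hypothesis Kh : expR (h * n%:R) <= K%:R.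

(** Chosen so that [4 * b = s * l * (kappa * n)], the least value of [s * l] times the squared
    distance of two members. The hypothesis [lh] bounds the density of the shift on a decoding
    region, in [P_shift]. The noise level [s] enters neither [c] nor [lh]. *)
Let c := l * kappa / 4.
Let b := c * s * n%:R.
Let a i (k : nat) : R := s * l * u i k.

Let c0 : 0 < c. Proof. by rewrite /c divr_gt0 ?mulr_gt0. Qed.

(* Codewords [a i] sent through the Gaussian channel: as long as no [u j]
   correlates with the noise, the received word can be decoded, so that the
   decoding regions [E i] are disjoint. *)
Let E i : set (seq_space R) :=
  [set z | (forall j, dot n (u j) (fun k => z k - a i k) < b) /\
           - b <= dot n (u i) (fun k => z k - a i k)].

Let measurable_dot_lt (v : nat -> R) x : measurable [set z : seq_space R | dot n v z < x].
Proof.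
have := @measurable_dot R n v measurableT `]-oo, x[%classic (measurable_itv _).
by rewrite setTI; congr measurable.
Qed.

Let measurable_dot_ge (v : nat -> R) x : measurable [set z : seq_space R | x <= dot n v z].
Proof.
have := @measurable_dot R n v measurableT `[x, +oo[%classic (measurable_itv _).
rewrite setTI; congr measurable.
by apply/seteqP; split=> z /=; rewrite in_itv/= andbT.
Qed.

Let mE i : measurable (E i).
Proof.
rewrite (_ : E i = (\bigcap_j [set z : seq_space R | dot n (u j) z < b + dot n (u j) (a i)]) `&`
   [set z : seq_space R | - b + dot n (u i) (a i) <= dot n (u i) z]).
  apply: measurableI; last exact: measurable_dot_ge.
  exact: fin_bigcap_measurable.
apply/seteqP; split=> z /=.
  move=> [h1 h2]; split=> [j _|]; last by rewrite dotBr in h2; lra.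
  by have := h1 j; rewrite dotBr/=; lra.
move=> [h1 h2]; split=> [j|]; last by rewrite dotBr; lra.
by have := h1 j I; rewrite dotBr/=; lra.
Qed.

(** For [z] in both regions the four inequalities add up to [s * l] times the squared distance of
    [u i] and [u j] being less than [4 * b], contrary to the separation. *)
Let E_disjoint : trivIset setT E.
Proof.
apply/trivIsetP => i j _ _ ij; rewrite -subset0 => z [[h1 h2] [h3 h4]].
have := usep ij.
have -> : \sum_(k < n) (u i k - u j k) ^+ 2 =
   dot n (fun k => u i k - u j k) (fun k => u i k - u j k).
  by apply: eq_bigr => k _; rewrite expr2.
have := h1 j; have := h3 i; move: h2 h4.
rewrite !dotBr !dotZr !dotBl (dotC n (u j) (u i)) => h2 h4 h5 h6.
have e : s * l * (dot n (u i) (u i) - dot n (u i) (u j) -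
   (dot n (u i) (u j) - dot n (u j) (u j))) < s * l * (kappa * n%:R).
  rewrite (_ : s * l * (kappa * n%:R) = 4 * b); last by rewrite /b /c; field.
  rewrite !mulrBr; lra.
rewrite ltr_pM2l ?mulr_gt0// in e.
by rewrite leNgt e.
Qed.

Let PE_sum : (\sum_(i < K) P (path @^-1` E i) <= 1)%E.
Proof.
rewrite -measure_bigsetU_ord//.
- apply: probability_le1; apply: bigsetU_measurable => i _.
  exact: measurable_pre_path.
- by move=> i; exact: measurable_pre_path.
- apply/trivIsetP => i j _ _ ij; rewrite -preimage_setI.
  by move/trivIsetP : E_disjoint => /(_ _ _ I I ij) ->; rewrite preimage_set0.
Qed.

(** On [E i] the path correlates with [u i] by less than [b + dot n (u i) (a i)]. The exponent of
    the density is thus at most [(l * c + l ^+ 2 * M ^+ 2 / 2) * n], which is the left side of [lh]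
    times [n]. *)
Let P_shift i : (P (shifted_path eps n (a i) @^-1` E i)
  <= (expR (h / 2 * n%:R))%:E * P (path @^-1` E i))%E.
Proof.
apply: (path_shift_le iid s0) => //.
move=> w [h1 _]; have {h1} := h1 i.
have e1 : dot n (a i) (path w) = s * l * dot n (u i) (path w) by exact: dotZl.
have e2 : dot n (a i) (a i) = (s * l) ^+ 2 * dot n (u i) (u i).
  by rewrite /a dotZl dotZr mulrA -expr2.
have e3 : dot n (u i) (a i) = s * l * dot n (u i) (u i) by exact: dotZr.
rewrite dotBr path_tiltE e1 e2 e3 /b ler_expR => h1.
have uu := dotxx_le (uM i).
rewrite ler_pdivrMr ?exprn_gt0//.
have h2 : s * l * dot n (u i) (path w) <=
    s * l * (c * s * n%:R) + s * l * (s * l * dot n (u i) (u i)).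
  by rewrite -mulrDr ler_pM2l ?mulr_gt0//; lra.
have h3 : (s * l) ^+ 2 / 2 * dot n (u i) (u i) <= (s * l) ^+ 2 / 2 * (M ^+ 2 * n%:R).
  by rewrite ler_wpM2l// divr_ge0// sqr_ge0.
have h4 : (s ^+ 2 * n%:R) * (l ^+ 2 * (kappa / 4 + M ^+ 2 / 2)) <= s ^+ 2 * n%:R * (h / 2).
  by rewrite ler_wpM2l// mulr_ge0// sqr_ge0.
move: h2 h3 h4; rewrite /c; lra.
Qed.

Let P_bad i : (P [set w | b <= dot n (fun k => - u i k) (path w)]%R
  <= (expR (- (c ^+ 2 / (2 * M ^+ 2) * n%:R)))%:E)%E.
Proof.
have uM' k : (k < n)%N -> `|- u i k| <= M by rewrite normrN; exact: uM.
have := @dot_deviation _ _ _ P eps s iid s0 n (fun k => - u i k) M (c * s) M0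
  (ltW (mulr_gt0 c0 s0)) uM'.
rewrite (_ : (c * s) ^+ 2 / (2 * M ^+ 2 * s ^+ 2) = c ^+ 2 / (2 * M ^+ 2))//.
by field; rewrite !gt_eqF.
Qed.

(** On the event, unless the noise correlates with [u i] below [- b], the shifted noise lies in
    [E i]. Thus [P G <= expR (h / 2 * n) * P (E i) + q] for each [i]. Summing over the disjoint
    regions gives [K * P G <= expR (h / 2 * n) + K * q], and [K >= expR (h * n)] makes the quotient
    exponentially small. *)
Lemma dot_lt_separated :
  (P [set w | forall i, dot n (u i) (path w) < c * s * n%:R]%R <=
  (2 * expR (- (Num.min (h / 2) (c ^+ 2 / (2 * M ^+ 2)) * n%:R)))%:E)%E.
Proof.
set G := [set w | _]; set al := Num.min _ _.
have mG : measurable G.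
  rewrite (_ : G = path @^-1` (\bigcap_j [set z : seq_space R | dot n (u j) z < b])).
    by apply: measurable_pre_path; exact: fin_bigcap_measurable.
  by apply/seteqP; split=> w /= h1 i; [move=> _|]; exact: h1.
have K0 : 0 < K%:R :> R by rewrite (lt_le_trans _ Kh)// expR_gt0.
set q := expR (- (c ^+ 2 / (2 * M ^+ 2) * n%:R)).
have PG i : (P G <= (expR (h / 2 * n%:R))%:E * P (path @^-1` E i) + q%:E)%E.
  apply: (le_trans _ (leeD (P_shift i) (P_bad i))).
  apply: le_trans (measureU2 _ _ _) => //.
  - apply: le_measure; rewrite ?inE//.
    + apply: measurableU.
        by rewrite -[X in measurable X]setTI; exact: measurable_shifted_path.
      by apply: (@measurable_pre_path _ _ _ _ eps [set z : seq_space R | b <= dot n (fun k => - u i k) z]).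
    + move=> w Gw; have [hb|hb] := leP b (dot n (fun k => - u i k) (path w)); [by right|left].
      have sE j : dot n (u j) (fun k => shifted_path eps n (a i) w k - a i k) = dot n (u j) (path w).
        by apply: eq_bigr => k _; rewrite /shifted_path ltn_ord addrK.
      split=> [j|]; rewrite sE; first exact: Gw.
      by move: hb; rewrite dotNl; lra.
  - by rewrite -[X in measurable X]setTI; exact: measurable_shifted_path.
  - by apply: (@measurable_pre_path _ _ _ _ eps [set z : seq_space R | b <= dot n (fun k => - u i k) z]).
have pf : P G \is a fin_num by apply: fin_num_measure.
have : (\sum_(i < K) P G <= (expR (h / 2 * n%:R) + K%:R * q)%:E)%E.
  apply: le_trans (lee_sum _ (fun i _ => PG i)) _.
  rewrite big_split/= -ge0_sume_distrr//.
  rewrite EFinD leeD//.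
    rewrite -[leRHS]mule1 lee_wpmul2l// lee_fin; exact: expR_ge0.
  by rewrite sumEFin lee_fin sumr_const card_ord mulr_natl.
rewrite -(fineK pf) sumEFin !lee_fin sumr_const card_ord -[leLHS]mulr_natl => hG.
have q1 : q <= expR (- (al * n%:R)).
  by rewrite ler_expR lerN2 ler_wpM2r// /al ge_min lexx orbT.
have q2 : expR (h / 2 * n%:R) <= K%:R * expR (- (al * n%:R)).
  apply: (@le_trans _ _ (expR (h * n%:R) * expR (- (al * n%:R)))); last first.
    by rewrite ler_pM2r ?expR_gt0.
  rewrite -expRD ler_expR.
  have : al * n%:R <= h / 2 * n%:R by rewrite ler_wpM2r// /al ge_min lexx.
  lra.
rewrite -(ler_pM2l K0); apply: (le_trans hG).
rewrite mulrCA; have := ler_wpM2l (ltW K0) q1; lra.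
Qed.

End SeparatedFamily.

(** * Almost sure bounds for correlations with the noise *)

Section AlmostSure.
Context {R : realType}.
Implicit Types (U : set (nat -> R)) (M t : R).

(** The deviation bound needs bounded centers; projecting them onto [[- M, M]] brings them no
    further from values in that interval. *)
Lemma sup_cover_clip U n (r M : R) K : 0 <= M -> (forall u k, U u -> `|u k| <= M) ->
  sup_cover U n r K -> exists2 c : 'I_K -> nat -> R, forall i k, `|c i k| <= M &
    forall u, U u -> exists i, forall k, (k < n)%N -> `|u k - c i k| < r.
Proof.
move=> M0 UM [c cP].
exists (fun i k => Num.max (- M) (Num.min M (c i k))) => [i k|u Uu].
  rewrite ler_norml; apply/andP; split; first by rewrite le_max lexx.
  by rewrite ge_max ge_min lexx/= andbT; lra.
have [i iP] := cP u Uu; exists i => k kn; apply: le_lt_trans (iP k kn).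
have := UM u k Uu; rewrite ler_norml => /andP[h1 h2].
have [h3|h3] := leP M (c i k).
  rewrite max_r; last by lra.
  by rewrite distrC [leRHS]distrC !ger0_norm; lra.
have [h4|h4] := leP (- M) (c i k); first by rewrite lexx.
by rewrite !ger0_norm; lra.
Qed.

Section Noise.
Context d (Omega : measurableType d) (P : probability Omega R).
Variables (eps : nat -> {RV P >-> R}) (s : R).
Hypotheses (iid : iid_centered_normal eps s) (s0 : 0 < s).
Local Notation path := (path_of eps).

Lemma measurable_dot_ge_path n (c : nat -> R) x :
  measurable [set w | x <= dot n c (path w)].
Proof.
apply: (@measurable_pre_path _ _ _ _ eps [set z : seq_space R | x <= dot n c z]).
have := @measurable_dot R n c measurableT `[x, +oo[%classic (measurable_itv _).
rewrite setTI; congr measurable.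
by apply/seteqP; split=> z /=; rewrite in_itv/= andbT.
Qed.

Lemma finite_dot_deviation (I : finType) n (c : I -> nat -> R) M t : 0 < M -> 0 <= t ->
  (forall i k, (k < n)%N -> `|c i k| <= M) ->
  (P (\bigcup_i [set w | t * n%:R <= dot n (c i) (path w)]%R)
    <= (#|I|%:R * expR (- (t ^+ 2 / (2 * M ^+ 2 * s ^+ 2) * n%:R)))%:E)%E.
Proof.
move=> M0 t0 cM.
have -> : \bigcup_i [set w | t * n%:R <= dot n (c i) (path w)] =
  \big[setU/set0]_(i : I) [set w | t * n%:R <= dot n (c i) (path w)].
  rewrite -bigcup_seq; apply: eq_bigcupl; split=> i //= _.
  by rewrite mem_index_enum.
set q := expR _.
suff : measurable (\big[setU/set0]_(i : I) [set w | t * n%:R <= dot n (c i) (path w)])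
  /\ (P (\big[setU/set0]_(i : I) [set w | t * n%:R <= dot n (c i) (path w)]%R)
    <= \sum_(i : I) q%:E)%E.
  by move=> [_]; rewrite sumEFin sumr_const mulr_natl.
apply: (big_ind2 (fun A (x : \bar R) => measurable A /\ (P A <= x)%E)).
- by split => //; rewrite measure0.
- move=> A x B y [mA PA] [mB PB]; split; first exact: measurableU.
  by apply: (le_trans (measureU2 _ _ _)) => //; exact: leeD.
- move=> i _; split; first exact: measurable_dot_ge_path.
  exact: (dot_deviation iid s0 M0 t0 (cM i)).
Qed.

(* The sum of the [`|eps k|] is the maximum of [dot n c] over the [2 ^ n] sign
   vectors [c]. *)
Lemma ae_sum_norm_le : exists2 C : R, 0 < C &
  {ae P, forall w, \forall n \near \oo, \sum_(k < n) `|eps k w| <= C * n%:R}.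
Proof.
(* The deviation rate is then 2, which beats the [2 ^ n <= expR n] sign vectors. *)
pose C := Num.sqrt (4 * s ^+ 2).
have C2 : C ^+ 2 / (2 * 1 ^+ 2 * s ^+ 2) = 2.
  have -> : C ^+ 2 = 4 * s ^+ 2 by rewrite sqr_sqrtr// mulr_ge0// sqr_ge0.
  by field; rewrite gt_eqF.
have C0 : 0 < C by rewrite sqrtr_gt0 mulr_gt0// exprn_gt0.
exists C => //.
pose I n : finType := {ffun 'I_n -> bool}.
pose c n (f : I n) (k : nat) : R := if insub k is Some k' then (-1) ^+ (f k') else 0.
pose E n := \bigcup_(f : I n) [set w | C * n%:R <= dot n (c n f) (path w)].
have mE n : measurable (E n).
  by apply: fin_bigcup_measurable => // f _; exact: measurable_dot_ge_path.
have PE n : (0 <= n)%N -> (P (E n) <= (1 * expR (- (1 * n%:R)))%:E)%E.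
  move=> _; apply: (le_trans (@finite_dot_deviation (I n) n (c n) 1 C _ _ _)) => //.
  - exact: ltW.
  - by move=> f k kn; rewrite /c insubT normrX normrN1 expr1n.
  rewrite C2 card_ffun card_bool card_ord lee_fin !mul1r natrX.
  apply: (@le_trans _ _ (expR 1 ^+ n * expR (- (2 * n%:R)))).
    rewrite ler_pM2r ?expR_gt0//; apply: lerXn2r; rewrite ?nnegrE ?expR_ge0//.
    by have := expR_ge1Dx (1 : R).
  by rewrite -expRM_natr -expRD ler_expR; lra.
apply: filterS (borel_cantelli_exp ler01 ltr01 mE PE) => w.
apply: filterS => n nE; rewrite leNgt; apply/negP => h; apply: nE.
exists [ffun k : 'I_n => eps k w < 0] => //=; apply/ltW; apply: (lt_le_trans h).
apply: ler_sum => k _; rewrite /c valK ffunE /path_of.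
have [h1|h1] := ltP (eps k w) 0.
  by rewrite expr1 mulN1r ltr0_norm.
by rewrite expr0 mul1r ger0_norm.
Qed.

(** Half of [t] is for the centers, whose deviation rate [x] exceeds their growth rate [x / 2]; the
    other half is for the approximation error, at most [r] times the sum of the absolute values of
    the noise. The radius and the rate are produced before [U], because [U] is later built from
    them. *)
Lemma ae_dot_le M t : 0 < M -> 0 < t ->
  exists2 r : R, 0 < r & exists2 eta : R, 0 < eta &
  forall U (D : R), 0 <= D -> (forall u k, U u -> `|u k| <= M) ->
    (forall n, exists2 K, sup_cover U n r K & K%:R <= D * expR (eta * n%:R)) ->
    {ae P, forall w, \forall n \near \oo, forall u, U u ->
       dot n u (path w) <= t * n%:R}.
Proof.
move=> M0 t0; have [C C0 aeC] := ae_sum_norm_le.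
pose x := (t / 2) ^+ 2 / (2 * M ^+ 2 * s ^+ 2).
have x0 : 0 < x by rewrite divr_gt0 ?exprn_gt0 ?mulr_gt0 ?exprn_gt0 ?divr_gt0.
exists (t / (2 * C)); first by rewrite divr_gt0 ?mulr_gt0.
exists (x / 2); first by rewrite divr_gt0.
set r := t / _; move=> U D D0 UM UK.
have {UK} UK n : exists Kc : {K : nat & 'I_K -> nat -> R},
    [/\ (tag Kc)%:R <= D * expR (x / 2 * n%:R),
       forall i k, `|tagged Kc i k| <= M &
       forall u, U u -> exists i, forall k, (k < n)%N -> `|u k - tagged Kc i k| < r].
  have [K cK Ke] := UK n; have [c cM cP] := sup_cover_clip (ltW M0) UM cK.
  by exists (existT _ K c).
have {UK} [Kc KcP] := choice UK.
pose E n := \bigcup_i [set w | t / 2 * n%:R <= dot n (tagged (Kc n) i) (path w)].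
have mE n : measurable (E n).
  by apply: fin_bigcup_measurable => // f _; exact: measurable_dot_ge_path.
have PE n : (0 <= n)%N -> (P (E n) <= (D * expR (- (x / 2 * n%:R)))%:E)%E.
  move=> _; have [h1 h2 _] := KcP n.
  apply: (le_trans (@finite_dot_deviation _ n (tagged (Kc n)) M (t / 2) _ _ _)) => //.
    by rewrite divr_ge0// ltW.
  rewrite card_ord lee_fin -/x.
  apply: (@le_trans _ _ (D * expR (x / 2 * n%:R) * expR (- (x * n%:R)))).
    by rewrite ler_pM2r ?expR_gt0.
  by rewrite -mulrA -expRD ler_wpM2l// ler_expR; lra.
apply: filterS2 aeC (borel_cantelli_exp D0 _ mE PE) => //; last by rewrite divr_gt0.
move=> w; apply: filterS2 => n hC nE u Uu.
have [_ _ /(_ u Uu)[i iP]] := KcP n.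
have h1 : dot n (tagged (Kc n) i) (path w) <= t / 2 * n%:R.
  by rewrite leNgt; apply/negP => h; apply: nE; exists i => //; exact: ltW.
have h2 : dot n (fun k => u k - tagged (Kc n) i k) (path w) <= t / 2 * n%:R.
  apply: (@le_trans _ _ (r * \sum_(k < n) `|eps k w|)).
    rewrite mulr_sumr; apply: ler_sum => k _; apply: (le_trans (ler_norm _)).
    by rewrite normrM ler_wpM2r//; exact/ltW/iP.
  rewrite (_ : t / 2 * n%:R = r * (C * n%:R)); last by rewrite /r; field; rewrite gt_eqF.
  by rewrite ler_pM2l// /r divr_gt0 ?mulr_gt0.
by rewrite dotBl in h2; lra.
Qed.

Lemma ae_dot_norm_le M t : 0 < M -> 0 < t ->
  exists2 r : R, 0 < r & exists2 eta : R, 0 < eta &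
  forall U (D : R), 0 <= D -> (forall u k, U u -> `|u k| <= M) ->
    (forall n, exists2 K, sup_cover U n r K & K%:R <= D * expR (eta * n%:R)) ->
    {ae P, forall w, \forall n \near \oo, forall u, U u ->
       `|dot n u (path w)| <= t * n%:R}.
Proof.
move=> M0 t0; have [r r0 [eta e0 H]] := ae_dot_le M0 t0.
exists r => //; exists eta => // U D D0 UM UK.
pose V : set (nat -> R) := [set u | U (fun k => - u k)].
have VM u k : V u -> `|u k| <= M by move=> Vu; rewrite -normrN; exact: (UM _ k Vu).
have VK n : exists2 K, sup_cover V n r K & K%:R <= D * expR (eta * n%:R).
  have [K [c cP] KD] := UK n; exists K => //.
  exists (fun i k => - c i k) => u /cP[i iP]; exists i => k /iP.
  by rewrite -normrN opprD !opprK.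
apply: filterS2 (H U D D0 UM UK) (H V D D0 VM VK) => w.
apply: filterS2 => n h1 h2 u Uu; rewrite ler_norml h1// andbT.
have := h2 (fun k => - u k); rewrite dotNl lerNl; apply.
by rewrite /V/=; under eq_fun do rewrite opprK.
Qed.

End Noise.

(** Here [c] precedes the probability space and [s]; this uniformity is what yields a threshold for
    the noise level. *)
Lemma ae_dot_ge M (r h : R) U : 0 < M -> 0 < r -> 0 < h ->
  (forall u k, U u -> `|u k| <= M) ->
  (forall n K, (0 < n)%N -> sup_cover U n r K -> expR (h * n%:R) < K%:R) ->
  exists2 c : R, 0 < c &
  forall d (Omega : measurableType d) (P : probability Omega R)
    (eps : nat -> {RV P >-> R}) (s : R),
    iid_centered_normal eps s -> 0 < s ->
    {ae P, forall w, \forall n \near \oo,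
       exists2 u, U u & c * s * n%:R <= dot n u (path_of eps w)}.
Proof.
move=> M0 r0 h0 UM UK.
have [kappa kappa0 kappaP] := separated_family M r0 h0.
have {}UK n : exists Kc : {K : nat & 'I_K -> nat -> R}, (0 < n)%N ->
    [/\ expR (h / 2 * n%:R) <= (tag Kc)%:R,
       forall i, U (tagged Kc i) &
       forall i j, i != j ->
         kappa * n%:R <= \sum_(k < n) (tagged Kc i k - tagged Kc j k) ^+ 2].
  case: n => [|n]; first by exists (existT _ 0%N (fun _ _ => 0)).
  have [|K [u uP]] := kappaP U n.+1 UM; first by move=> K; exact: UK.
  by exists (existT _ K u).
have {UK} [Kc KcP] := choice UK.
pose y := kappa / 4 + M ^+ 2 / 2.
have y0 : 0 < y by rewrite addr_gt0// divr_gt0// exprn_gt0.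
(* The largest value satisfying the constraint of the coding argument for the rate [h / 2], which is
   the growth rate of the separated families. *)
pose l := Num.sqrt (h / 2 / 2 / y).
have l0 : 0 < l by rewrite sqrtr_gt0 !divr_gt0.
have lh : l ^+ 2 * y <= h / 2 / 2.
  by rewrite sqr_sqrtr ?divfK ?gt_eqF// !divr_ge0 ?(ltW h0) ?(ltW y0).
pose c := l * kappa / 4.
have c0 : 0 < c by rewrite divr_gt0 ?mulr_gt0.
exists c => // d Omega P eps s iid s0.
pose E n := [set w | forall i, dot n (tagged (Kc n) i) (path_of eps w) < c * s * n%:R].
have mE n : measurable (E n).
  rewrite (_ : E n = \bigcap_i ~` [set w | c * s * n%:R <= dot n (tagged (Kc n) i) (path_of eps w)]).
    apply: fin_bigcap_measurable => // i _; apply: measurableC.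
    exact: measurable_dot_ge_path.
  apply/seteqP; split=> w /= hw i.
    by move=> _; apply/negP; rewrite -ltNge; exact: hw.
  by rewrite ltNge; apply/negP; exact: hw.
pose al := Num.min (h / 2 / 2) (c ^+ 2 / (2 * M ^+ 2)).
have al0 : 0 < al by rewrite lt_min !divr_gt0 ?mulr_gt0 ?exprn_gt0.
have PE n : (1 <= n)%N -> (P (E n) <= (2 * expR (- (al * n%:R)))%:E)%E.
  move=> n0; have [h1 h2 h3] := KcP n n0.
  apply: (@dot_lt_separated _ _ _ _ eps s iid s0 kappa M (h / 2) l) => //.
  by move=> i k _; exact/UM/h2.
apply: filterS (borel_cantelli_exp (ler0n _ 2) al0 mE PE) => w.
move=> nE; near=> n.
have n0 : (0 < n)%N by near: n; exists 1%N.
have [_ h2 _] := KcP n n0.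
have : ~ E n w by near: n.
move=> /existsNP[i /negP]; rewrite -leNgt => hi.
by exists (tagged (Kc n) i).
Unshelve. all: by end_near. Qed.
End AlmostSure.

(** * Least squares over a continuous family *)

Section ContinuousFamily.
Context {R : realType} {X Theta : pmetricType R}.
Variables (T : Theta -> X -> X) (f : Theta -> X -> R).
Hypothesis cont : continuous_family T f.

Lemma orbit_seq_bounded : exists2 M : R, 0 < M &
  forall theta x k, `|orbit_seq T f theta x k| <= M.
Proof.
have [cX cTh _ cf] := cont.
suff [M M0 HM] : exists2 M : R, 0 < M & forall z : Theta * X, `|f z.1 z.2| <= M.
  by exists M => // theta x k; exact: (HM (theta, _)).
have cTX : compact [set: Theta * X] by rewrite -setXTT; exact: compact_setX.
have nearM : \forall M \near +oo, [set: Theta * X] `<=` (fun z => `|f z.1 z.2| <= M).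
  apply: ((compact_near_coveringP _).1 cTX) => z _.
  have h : \forall z' \near z, `|f z.1 z.2 - f z'.1 z'.2| < 1.
    have /cvgrPdist_lt := cf z; exact.
  near=> z' M => /=.
  have h1 : `|f z.1 z.2 - f z'.1 z'.2| < 1 by near: z'.
  have h2 : `|f z.1 z.2| + 1 <= M by near: M; exact: nbhs_pinfty_ge.
  have h3 := ler_normB (f z.1 z.2) (f z.1 z.2 - f z'.1 z'.2).
  rewrite opprB addrCA subrr addr0 in h3.
  lra.
near (pinfty_nbhs R) => M; exists M; first by near: M; exact: nbhs_pinfty_gt.
by move=> z; apply: (near nearM M).
Unshelve. all: by end_near. Qed.

Lemma orbit_seqS theta x k :
  orbit_seq T f theta x k.+1 = orbit_seq T f theta (T theta x) k.
Proof. by rewrite /orbit_seq iterSr. Qed.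

Lemma orbit_seqD theta x j k :
  orbit_seq T f theta x (j + k) = orbit_seq T f theta (iter j (T theta) x) k.
Proof. by rewrite /orbit_seq addnC iterD. Qed.

Lemma orbit_seq_continuous k :
  continuous (fun z : Theta * X => orbit_seq T f z.1 z.2 k).
Proof.
have [_ _ cT cf] := cont.
have ck : continuous (fun z : Theta * X => (z.1, iter k (T z.1) z.2)).
  elim: k => [|k IH] z; first by apply: cvg_pair; [exact: cvg_fst|exact: cvg_snd].
  apply: cvg_pair; first exact: cvg_fst.
  exact: (cvg_comp _ _ (IH z) (cT _)).
by move=> z; exact: (cvg_comp _ _ (ck z) (cf _)).
Qed.

(** Joint continuity gives this near each point [x]; compactness of [X] makes the neighbourhood of
    [theta0] uniform in [x]. *)
Lemma orbit_seq_near theta0 N (r : R) : 0 < r ->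
  \forall theta \near theta0, forall x k, (k < N)%N ->
    `|orbit_seq T f theta x k - orbit_seq T f theta0 x k| < r.
Proof.
move=> r0; have [cX _ _ _] := cont.
have H k : \forall theta \near theta0, [set: X] `<=`
    (fun x => `|orbit_seq T f theta x k - orbit_seq T f theta0 x k| < r).
  apply: ((compact_near_coveringP _).1 cX) => x _.
  have r2 : 0 < r / 2 by rewrite divr_gt0.
  have /cvgrPdist_lt/(_ _ r2) h := @orbit_seq_continuous k (theta0, x).
  have [[A B] [/= hA hB] AB] := h.
  exists (B, A) => // -[x' theta] /= [Bx' Ath].
  have e1 : `|orbit_seq T f theta0 x k - orbit_seq T f theta0 x' k| < r / 2.
    by apply: (AB (theta0, x')); split => //; exact: nbhs_singleton.
  have e2 : `|orbit_seq T f theta0 x k - orbit_seq T f theta x' k| < r / 2.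
    exact: (AB (theta, x')).
  rewrite (_ : _ - _ = (orbit_seq T f theta0 x k - orbit_seq T f theta0 x' k)
   - (orbit_seq T f theta0 x k - orbit_seq T f theta x' k)); last by ring.
  apply: (le_lt_trans (ler_normB _ _)); lra.
elim: N => [|N IH]; first by near=> theta.
apply: filterS2 IH (H N) => theta h1 h2 x k.
by rewrite ltnS leq_eqVlt => /predU1P[->|]; [exact: h2|exact: h1].
Unshelve. all: by end_near. Qed.

Lemma shift_closed_orbits (S : set Theta) :
  shift_closed [set u | exists theta x, S theta /\ u = orbit_seq T f theta x].
Proof.
move=> u [theta [x [St ->]]]; exists theta, (T theta x); split => //.
by apply/funext => k; rewrite orbit_seqS.
Qed.

End ContinuousFamily.

Section Risk.
Context {R : realType} {X Theta : pmetricType R}.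
Variables (T : Theta -> X -> X) (f : Theta -> X -> R).
Implicit Types (v e : nat -> R) (n : nat).

Lemma emp_riskE v e n theta x : let u := orbit_seq T f theta x in
  emp_risk T f (fun k => v k + e k) n theta x =
  n%:R^-1 * (dot n e e + dot n (fun k => u k - v k) (fun k => u k - v k)
             - 2 * dot n u e + 2 * dot n v e).
Proof.
move=> u; rewrite /emp_risk; congr (_ * _).
rewrite !mulr_sumr -big_split -sumrB -big_split /=; apply: eq_bigr => k _.
by rewrite -/u; ring.
Qed.

Lemma emp_risk_ge0 y n theta x : 0 <= emp_risk T f y n theta x.
Proof. by rewrite mulr_ge0// sumr_ge0// => k _; exact: sqr_ge0. Qed.

Lemma min_risk_ge (y : nat -> R) n theta (a : R) :
  (forall x, a <= emp_risk T f y n theta x) -> a <= min_risk T f y n theta.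
Proof.
move=> h; apply: lb_le_inf; first by exists (emp_risk T f y n theta point); exists point.
by move=> _ [x _ <-].
Qed.

Lemma inf_min_risk_le (y : nat -> R) n theta x :
  inf (range (min_risk T f y n)) <= emp_risk T f y n theta x.
Proof.
apply: (@le_trans _ _ (min_risk T f y n theta)).
  apply: ge_inf; last by exists theta.
  by exists 0 => _ [th _ <-]; apply: min_risk_ge => ?; exact: emp_risk_ge0.
apply: ge_inf; last by exists x.
by exists 0 => _ [x' _ <-]; exact: emp_risk_ge0.
Qed.

End Risk.

Section ModelProcess.
Context {R : realType} {X Theta : pmetricType R}.
Variables (T : Theta -> X -> X) (f : Theta -> X -> R).
Variables (theta0 : Theta) (nu : probability (seq_space R) R).
Hypothesis model_nu : model_processes T f theta0 nu.
Context d (Omega : measurableType d) (P : probability Omega R).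
Variable V : nat -> {RV P >-> R}.
Hypothesis lawV : has_law V nu.

(** The law of [V] is the image of a measure on [X] under the orbit map, so a measurable set
    containing all orbits at [theta0] has full probability. *)
Lemma ae_model_process (A : set (seq_space R)) : measurable A ->
  (forall x, A (orbit_seq T f theta0 x)) -> {ae P, forall w, A (path_of V w)}.
Proof.
move=> mA Aorb; have [mu [_ muA]] := model_nu.
have mVA : measurable (path_of V @^-1` A) by exact: measurable_pre_path.
have PVA : P (path_of V @^-1` A) = 1%E.
  rewrite lawV// muA// (_ : _ @^-1` A = setT) ?probability_setT//.
  by apply/seteqP; split => // x _; exact: Aorb.
have PVA0 : P (~` (path_of V @^-1` A)) = 0%E.
  by rewrite probability_setC// PVA subee.
by apply: negligibleS ((negligibleP P (measurableC mVA)).2 PVA0) => w.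
Qed.

End ModelProcess.

Section BlockwiseSets.
Context {R : realType}.

Lemma measurable_blockwise N K (c : 'I_K -> nat -> R) (r : R) :
  measurable (blockwise N c r : set (seq_space R)).
Proof.
rewrite (_ : blockwise N c r = \bigcap_j \bigcup_i \bigcap_(k < N)
  ((fun z : seq_space R => z (j * N + k)%N) @^-1` [set x | `|x - c i k| < r])).
  apply: bigcapT_measurable => j; apply: fin_bigcup_measurable => // i _.
  apply: bigcap_measurableType => k _.
  rewrite -[X in measurable X]setTI; apply: measurable_coord => //.
  rewrite (_ : mkset _ = `]c i k - r, c i k + r[%classic); first exact: measurable_itv.
  by apply/seteqP; split=> x /=; rewrite in_itv/= ltr_distl.
apply/seteqP; split=> z /= h.
  by move=> j _; have [i hi] := h j; exists i.
by move=> j; have [i _ hi] := h j I; exists i.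
Qed.

Lemma measurable_bounded_seq (M : R) :
  measurable [set z : seq_space R | forall k, `|z k| <= M].
Proof.
rewrite (_ : mkset _ = \bigcap_k
  ((fun z : seq_space R => z k) @^-1` [set x | `|x| <= M])).
  apply: bigcapT_measurable => k.
  rewrite -[X in measurable X]setTI; apply: measurable_coord => //.
  rewrite (_ : mkset _ = `[- M, M]%classic); first exact: measurable_itv.
  by apply/seteqP; split=> x /=; rewrite in_itv/= ler_norml.
by apply/seteqP; split=> z /= h k; [move=> _; exact: h | exact: h].
Qed.

(** The constant factor [expR (eta * N)] pays for the last, incomplete block. *)
Lemma expn_block_le (K N n : nat) (eta : R) : 0 <= eta ->
  K%:R <= expR (eta * N%:R) ->
  (K ^ (n %/ N).+1)%:R <= expR (eta * N%:R) * expR (eta * n%:R).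
Proof.
move=> e0 hK; rewrite natrX.
apply: (@le_trans _ _ (expR (eta * N%:R) ^+ (n %/ N).+1)).
  by apply: lerXn2r; rewrite ?nnegrE ?expR_ge0.
rewrite -expRM_natr -expRD ler_expR -mulrA -natrM -mulrDr ler_wpM2l// -natrD ler_nat.
by rewrite mulnS leq_add2l mulnC leq_trunc_div.
Qed.

End BlockwiseSets.

Lemma cvg_dist_to_set0 (R : realType) (M : pmetricType R) (A : set M) (x : nat -> M) :
  (\forall n \near \oo, A (x n)) -> dist_to_set A (x n) @[n --> \oo] --> 0%E.
Proof.
move=> Ax; apply: cvg_near_cst; apply: filterS Ax => n Axn.
apply/eqP; rewrite eq_le; apply/andP; split.
  by apply: ereal_inf_lbound; exists (x n) => //; rewrite mdistxx.
by apply: le_ereal_inf_tmp => _ [a _ <-]; rewrite lee_fin mdist_ge0.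
Qed.

(** * Avoiding a neighbourhood of the true parameter *)

Section Inconsistency.
Context {R : realType} {X Theta : pmetricType R}.
Variables (T : Theta -> X -> X) (f : Theta -> X -> R) (theta0 : Theta).
Hypothesis cont : continuous_family T f.
Variables (p : \bar R) (M : R).
Hypotheses (p1 : (1 <= p)%E) (M0 : 0 < M).
Hypothesis fM : forall theta x k, `|orbit_seq T f theta x k| <= M.
Hypothesis zero_entropy : entropy T f p [set theta0] = 0%E.
Variable nuV : probability (seq_space R) R.
Hypothesis modelV : model_processes T f theta0 nuV.
Context d (Omega : measurableType d) (P : probability Omega R).
Variables (V eps : nat -> {RV P >-> R}) (s : R).
Hypotheses (lawV : has_law V nuV) (iid : iid_centered_normal eps s) (s0 : 0 < s).

(* Near [theta0] every orbit, like almost every path of [V], is blockwise close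
   to one of few words: such sequences barely correlate with the noise. *)
Lemma ae_small_correlation : exists2 B, nbhs theta0 B &
  {ae P, forall w, \forall n \near \oo,
    `|dot n (path_of V w) (path_of eps w)| <= n%:R /\
    forall theta x, B theta ->
      `|dot n (orbit_seq T f theta x) (path_of eps w)| <= n%:R}.
Proof.
have [r r0 [eta e0 H]] := ae_dot_norm_le iid s0 M0 ltr01.
pose U := [set u | exists theta x, [set theta0] theta /\ u = orbit_seq T f theta x].
have UM u k : U u -> `|u k| <= M by move=> [th [x [_ ->]]].
have r2 : 0 < r / 2 by rewrite divr_gt0.
have [N N0 [K [c cP] KN]] := entropy0_sup_cover p1 UM zero_entropy r2 e0.
pose W := blockwise N c r `&` [set u | forall k, `|u k| <= M].
pose B := [set theta | forall x k, (k < N)%N ->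
    `|orbit_seq T f theta x k - orbit_seq T f theta0 x k| < r / 2].
have nB : nbhs theta0 B by exact: orbit_seq_near.
have WB theta x : B theta -> W (orbit_seq T f theta x).
  move=> Bt; split; last by move=> k; exact: fM.
  (* In every block the comparison orbit at [theta0] restarts from the current point of the orbit at
     [theta], so errors do not accumulate. Half of [r] is spent on the change of parameter, half on
     the cover. *)
  move=> j; have [|i iP] := cP (orbit_seq T f theta0 (iter (j * N) (T theta) x)).
    by exists theta0, (iter (j * N) (T theta) x).
  exists i => k kN; rewrite orbit_seqD.
  have := iP k kN; have := Bt (iter (j * N) (T theta) x) k kN.
  by rewrite !ltr_norml => /andP[? ?] /andP[? ?]; apply/andP; split; lra.
have WV : {ae P, forall w, W (path_of V w)}.
  apply: (ae_model_process modelV lawV).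
    by apply: measurableI; [exact: measurable_blockwise|exact: measurable_bounded_seq].
  by move=> x; apply: WB; exact: nbhs_singleton.
exists B => //.
have WK n : exists2 K', sup_cover W n r K' & K'%:R <= expR (eta * N%:R) * expR (eta * n%:R).
  exists (K ^ (n %/ N).+1)%N; last by apply: expn_block_le => //; exact: ltW.
  by apply: sup_cover_subset (sup_cover_blockwise c r n N0) => u [].
have WM u k : W u -> `|u k| <= M by move=> [_]; exact.
apply: filterS2 WV (H W _ (expR_ge0 _) WM WK) => w Ww.
apply: filterS => n; rewrite mul1r => h; split; first exact: h.
by move=> theta x /(WB _ x); exact: h.
Qed.

(** With [A] the mean square of the noise, the risk on [B] is at least [A - 4], while the infimum
    over all models is at most [A + 4 * M ^+ 2 - 2 * (c * s) + 2]. The assumption makes the gap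
    exceed 1, whereas the excess risk of least squares estimates tends to 0. *)
Lemma ae_estimate_avoids (c : R) : 4 * M ^+ 2 + 7 < 2 * (c * s) ->
  {ae P, forall w, \forall n \near \oo, exists theta x,
       c * s * n%:R <= dot n (orbit_seq T f theta x) (path_of eps w)} ->
  exists2 B, nbhs theta0 B &
  forall theta_ : forall n : nat, n.-tuple R -> Theta,
  let Y : nat -> Omega -> R := fun k w => V k w + eps k w in
  least_squares_estimates T f P Y theta_ ->
  {ae P, forall w, \forall n \near \oo, ~ B (estimate theta_ (Y ^~ w) n)}.
Proof.
move=> cs aelarge; have [B nB aesmall] := ae_small_correlation.
exists B => // theta_ Y [_ aelim].
have aeVM : {ae P, forall w, forall k, `|V k w| <= M}.
  apply: (ae_model_process modelV lawV (measurable_bounded_seq M)).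
  by move=> x k; exact: fM.
near=> w.
have [l [cvg1 cvg2]] : let y := fun k => Y k w in exists l : R,
       min_risk T f y n (estimate theta_ y n) @[n --> \oo] --> l /\
       inf (range (min_risk T f y n)) @[n --> \oo] --> l by near: w.
have VM k : `|V k w| <= M by move: k; near: w.
have cvgB : min_risk T f (Y ^~ w) n (estimate theta_ (Y ^~ w) n) -
    inf (range (min_risk T f (Y ^~ w) n)) @[n --> \oo] --> (0 : R).
  by rewrite -(subrr l); exact: cvgB.
have hlarge : \forall n \near \oo, exists theta x,
   c * s * n%:R <= dot n (orbit_seq T f theta x) (path_of eps w) by near: w.
have hsmall : \forall n \near \oo,
    `|dot n (path_of V w) (path_of eps w)| <= n%:R /\
    forall theta x, B theta ->
      `|dot n (orbit_seq T f theta x) (path_of eps w)| <= n%:R by near: w.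
have hdiff : \forall n \near \oo,
    min_risk T f (Y ^~ w) n (estimate theta_ (Y ^~ w) n) -
    inf (range (min_risk T f (Y ^~ w) n)) < 1.
  move/cvgrPdist_lt : cvgB => /(_ 1 ltr01); apply: filterS => n.
  by rewrite sub0r normrN => /(le_lt_trans (ler_norm _)).
near=> n.
have n0 : (0 < n)%N by near: n; exists 1%N.
have n0' : 0 < n%:R :> R by rewrite ltr0n.
have [theta [x large]] : exists theta x,
   c * s * n%:R <= dot n (orbit_seq T f theta x) (path_of eps w) by near: n.
have [smallV small] : `|dot n (path_of V w) (path_of eps w)| <= n%:R /\
    forall theta x, B theta ->
      `|dot n (orbit_seq T f theta x) (path_of eps w)| <= n%:R by near: n.
have : min_risk T f (Y ^~ w) n (estimate theta_ (Y ^~ w) n) -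
    inf (range (min_risk T f (Y ^~ w) n)) < 1 by near: n.
set th := estimate theta_ _ n => diff Bth.
set A := n%:R^-1 * dot n (path_of eps w) (path_of eps w).
move: smallV; rewrite ler_norml => /andP[V1 V2].
have low : A - 4 <= min_risk T f (Y ^~ w) n th.
  apply: min_risk_ge => x'.
  have /(_ n th x') := @emp_riskE _ _ _ T f (path_of V w) (path_of eps w) => /= ->.
  have := small th x' Bth; rewrite ler_norml => /andP[u1 u2].
  rewrite -(ler_pM2l n0') mulVKf ?gt_eqF// mulrBr mulVKf ?gt_eqF//.
  have := @dotxx_ge0 _ n (fun k => orbit_seq T f th x' k - path_of V w k).
  lra.
have up : inf (range (min_risk T f (Y ^~ w) n)) <= A + 4 * M ^+ 2 - 2 * (c * s) + 2.
  apply: (le_trans (inf_min_risk_le T f (Y ^~ w) n theta x)).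
  have /(_ n theta x) := @emp_riskE _ _ _ T f (path_of V w) (path_of eps w) => /= ->.
  have uv : dot n (fun k => orbit_seq T f theta x k - path_of V w k)
     (fun k => orbit_seq T f theta x k - path_of V w k) <= (M + M) ^+ 2 * n%:R.
    apply: dotxx_le => k _; apply: (le_trans (ler_normB _ _)).
    by apply: lerD; [exact: fM|exact: VM].
  rewrite -(ler_pM2l n0') mulVKf ?gt_eqF// !mulrDr mulVKf ?gt_eqF//.
  lra.
lra.
Unshelve. all: by end_near. Qed.

End Inconsistency.

Lemma least_squares_inconsistent (R : realType) (p : \bar R) (X Theta : pmetricType R)
      (T : Theta -> X -> X) (f : Theta -> X -> R)
      (theta0 : Theta) (nuV : probability (seq_space R) R) :
    (1 <= p)%E ->
    continuous_family T f ->
    (0 < entropy T f p [set: Theta])%E ->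
    entropy T f p [set theta0] = 0%E ->
    (model_processes T f theta0 `\`
      \bigcup_(theta in [set theta | theta <> theta0])
        model_processes T f theta) nuV ->
    exists sigma0 : R, 0 < sigma0 /\
      forall (sigma : R) (d : measure_display) (Omega : measurableType d)
          (P : probability Omega R) (V eps : nat -> {RV P >-> R}),
        sigma0 < sigma ->
        has_law V nuV ->
        iid_centered_normal eps sigma ->
        let Y : nat -> Omega -> R := fun k w => V k w + eps k w in
        exists Theta_star : set Theta,
          [/\ compact Theta_star,
              Theta_star !=set0,
              forall theta_ : forall n : nat, n.-tuple R -> Theta,
                least_squares_estimates T f P Y theta_ ->
                {ae P, forall w,
                  dist_to_set Theta_star (estimate theta_ (Y ^~ w) n)
                    @[n --> \oo] --> 0%E}
            & ~ (\bigcup_(theta in Theta_star)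
                   model_processes T f theta) nuV].
Proof.
move=> p1 cont hD h0 [modelV nmodelV].
have [M M0 fM] := orbit_seq_bounded cont.
pose U := [set u | exists theta x, [set: Theta] theta /\ u = orbit_seq T f theta x].
have UM u k : U u -> `|u k| <= M by move=> [th [x [_ ->]]].
have U0 : U !=set0 by exists (orbit_seq T f point point), point, point.
have [r r0 [h h_gt0 hP]] := entropy_gt0_sup_cover p1 U0 (@shift_closed_orbits _ _ _ T f setT) hD.
have [c c0 large] := ae_dot_ge M0 r0 h_gt0 UM hP.
(* The entropies of the family and of the model at [theta0] differ, so [theta0] is not the only
   parameter. *)
have [theta1 ne1] : exists theta1, theta1 <> theta0.
  apply: contrapT => ne; move: hD; rewrite (_ : setT = [set theta0]) ?h0 ?ltxx//.
  apply/seteqP; split=> // th _; apply: contrapT => nth; apply: ne; by exists th.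
exists ((4 * M ^+ 2 + 7) / (2 * c)); split.
  by rewrite divr_gt0 ?mulr_gt0// addr_gt0// mulr_gt0// exprn_gt0.
move=> s d Omega P V eps hs lawV iid Y.
have s0 : 0 < s.
  apply: lt_trans hs.
  by rewrite divr_gt0 ?mulr_gt0// addr_gt0// mulr_gt0// exprn_gt0.
have cs : 4 * M ^+ 2 + 7 < 2 * (c * s).
  by move: hs; rewrite ltr_pdivrMr ?mulr_gt0//; lra.
have large' : {ae P, forall w, \forall n \near \oo, exists theta x,
       c * s * n%:R <= dot n (orbit_seq T f theta x) (path_of eps w)}.
  apply: filterS (large _ _ P eps s iid s0) => w; apply: filterS => n.
  by move=> [_ [theta [x [_ ->]]] hx]; exists theta, x.
have [B nB HB] := ae_estimate_avoids cont p1 M0 fM h0 modelV lawV iid s0 cs large'.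
(* Leaving out [theta1] keeps the complement nonempty; the distance to an empty set would be
   infinite. *)
pose B1 := B `&` ~` [set theta1].
have nB1 : nbhs theta0 B1.
  apply: filterI => //; apply: open_nbhs_nbhs; split; last exact/nesym.
  by rewrite openC; apply: accessible_closed_set1; apply: hausdorff_accessible; exact: metric_hausdorff.
have [_ cTheta _ _] := cont.
exists (~` B1^°); split.
- apply: subclosed_compact cTheta _ => //.
  by rewrite closedC; exact: open_interior.
- by exists theta1 => /interior_subset[_ /(_ erefl)].
- move=> theta_ lse; apply: filterS (HB theta_ lse) => w hw.
  apply: cvg_dist_to_set0; apply: filterS hw => n nBn.
  by move=> /interior_subset[].
- move=> [theta nB1th modelth]; apply: nmodelV; exists theta => //= e.
  by apply: nB1th; rewrite e.
Qed.

(** * The example *)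

Record unit_itv (R : realType) : Type :=
  UnitItv { unit_val : R; unit_valP : 0 <= unit_val <= 1 }.

Section UnitInterval.
Context {R : realType}.

HB.instance Definition _ := gen_eqMixin (unit_itv R).
HB.instance Definition _ := gen_choiceMixin (unit_itv R).

Let itv00 : 0 <= (0 : R) <= 1. Proof. by rewrite lexx ler01. Qed.

HB.instance Definition _ := isPointed.Build (unit_itv R) (UnitItv itv00).

Implicit Types x y : unit_itv R.

Lemma unit_itv_ge0 x : 0 <= unit_val x. Proof. by have /andP[] := unit_valP x. Qed.
Lemma unit_itv_le1 x : unit_val x <= 1. Proof. by have /andP[] := unit_valP x. Qed.

Lemma unit_itv_inj x y : unit_val x = unit_val y -> x = y.
Proof.
move: x y => [x hx] [y hy] /= xy; rewrite xy in hx *.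
by congr UnitItv; exact: bool_irrelevance.
Qed.

Let unit_dist x y : R := `|unit_val x - unit_val y|.

Let unit_distxx x : unit_dist x x = 0.
Proof. by rewrite /unit_dist subrr normr0. Qed.

Let unit_dist_positivity x y : unit_dist x y = 0 -> x = y.
Proof. by move/normr0_eq0/eqP; rewrite subr_eq0 => /eqP/unit_itv_inj. Qed.

Let unit_dist_sym x y : unit_dist x y = unit_dist y x.
Proof. exact: distrC. Qed.

Let unit_dist_triangle y x z : unit_dist x z <= unit_dist x y + unit_dist y z.
Proof. exact: ler_distD. Qed.

HB.instance Definition _ := isMetric.Build R (unit_itv R)
  unit_distxx unit_dist_positivity unit_dist_sym unit_dist_triangle.

Lemma mdist_unit_itv x y : mdist x y = `|unit_val x - unit_val y|.
Proof. by []. Qed.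

Lemma continuous_unit_val : continuous (@unit_val R).
Proof.
move=> x.
apply/(@cvgrPdist_lt R R^o _ (nbhs x) (nbhs_filter x)) => e e0.
by apply/nbhs_ballP; exists e => //= y; rewrite ballEmdist.
Qed.

Let clamp_subproof (y : R) : 0 <= Num.max 0 (Num.min 1 y) <= 1.
Proof. by rewrite le_max lexx/= ge_max ler01 ge_min lexx. Qed.

(** A 1-Lipschitz retraction of the line: it makes maps into the interval total, and compactness
    follows as it maps the segment onto the whole type. *)
Definition clamp (y : R) : unit_itv R := UnitItv (clamp_subproof y).

Lemma clampE (y : R) : 0 <= y <= 1 -> unit_val (clamp y) = y.
Proof. by move=> /andP[y0 y1] /=; rewrite min_r// max_r. Qed.

Lemma clamp_lipschitz (y z : R) : `|unit_val (clamp y) - unit_val (clamp z)| <= `|y - z|.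
Proof.
rewrite /=.
have [y1|y1] := leP 1 y; have [z1|z1] := leP 1 z; rewrite ?(max_r ler01).
- by rewrite subrr normr0.
- have [z0|z0] := leP 0 z; first by rewrite !ger0_norm; lra.
  by rewrite !ger0_norm; lra.
- have [y0|y0] := leP 0 y; first by rewrite distrC [leRHS]distrC !ger0_norm; lra.
  by rewrite distrC [leRHS]distrC !ger0_norm; lra.
- have [y0|y0] := leP 0 y; have [z0|z0] := leP 0 z => //.
  + by rewrite !ger0_norm; lra.
  + by rewrite distrC [leRHS]distrC !ger0_norm; lra.
  + by rewrite subrr normr0.
Qed.

Lemma continuous_clamp : continuous clamp.
Proof.
move=> y; apply/metricType_numDomainType.cvgrPdist_lt => e e0; near=> z.
rewrite mdist_unit_itv; apply: (le_lt_trans (clamp_lipschitz _ _)).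
near: z; exact: (@cvgr_dist_lt _ _ _ _ _ id).
Unshelve. all: by end_near. Qed.

Lemma compact_unit_itv : compact [set: unit_itv R].
Proof.
have -> : [set: unit_itv R] = clamp @` `[0, 1]%classic.
  apply/seteqP; split=> // x _; exists (unit_val x); first by rewrite /= in_itv/= (unit_valP x).
  by apply: unit_itv_inj; rewrite clampE// (unit_valP x).
apply: continuous_compact; last exact: segment_compact.
exact/continuous_subspaceT/continuous_clamp.
Qed.

End UnitInterval.

Lemma seq_entropy_set1 (R : realType) (p : \bar R) (u : nat -> R) :
  (1 <= p)%E -> seq_entropy p [set u] = 0%E.
Proof.
move=> p1.
have e0 r : 0 < r -> entropy_at p [set u] r = 0%E.
  move=> r0; suff cn n : covering_number [set u] r (dist_np n p) = 1%E.
    by apply/eqP; rewrite eq_le; apply/andP; split;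
      [apply: limn_esup_le|apply: limn_esup_ge]; apply: nearW => n;
      rewrite cn lne1 mule0.
  apply/eqP; rewrite eq_le; apply/andP; split.
    apply: ereal_inf_lbound; exists 1%N => //=; exists (fun=> u) => _ ->.
    exists ord0; apply: le_lt_trans r0.
    by apply: dist_np_le => // k _; rewrite subrr normr0.
  apply: le_ereal_inf_tmp => _ [K [c /(_ u erefl)[i _]] <-].
  by rewrite lee_fin ler1n (leq_ltn_trans _ (ltn_ord i)).
rewrite seq_entropyE (_ : [set _ | _ in _] = [set 0%E]) ?ereal_sup1//.
apply/seteqP; split => [_ [r /= r0 <-]|_ ->].
  by rewrite e0//; move: r0; rewrite in_itv/= andbT.
by exists 1; rewrite /= ?e0// in_itv/= ltr01.
Qed.

Lemma eq_dirac (R : realType) d1 d2 (T1 : measurableType d1) (T2 : measurableType d2)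
  (a : T1) (b : T2) (A : set T1) (B : set T2) : (A a <-> B b) ->
  (\d_ a : probability T1 R) A = (\d_ b : probability T2 R) B.
Proof.
move=> AB; rewrite /= !diracE.
by have -> : (a \in A) = (b \in B) by apply/idP/idP; rewrite !inE => /AB.
Qed.

Lemma dirac_in (R : realType) d (T : measurableType d) (a : T) (A : set T) :
  A a -> (\d_ a : probability T R) A = 1%E.
Proof. by move=> Aa; rewrite /= diracE mem_set. Qed.

Lemma dirac_zero_one (R : realType) d (T : measurableType d) (a : T) (A : set T) :
  (\d_ a : probability T R) A = 0%E \/ (\d_ a : probability T R) A = 1%E.
Proof. by rewrite /= diracE; case: (_ \in _); [right|left]. Qed.

Section Horseshoe.
Context {R : realType}.
Notation I := (unit_itv R).

(* Both [0, 1/3] and [2/3, 1] are mapped affinely onto [0, 1]. *)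
Definition horseshoe (x : I) : I :=
  clamp (Num.min (3 * unit_val x) (3 * (1 - unit_val x))).

(** The factor [1 + x] never vanishes: parameter 0 observes only zeros, every other parameter only
    positive values, and parameter 1 sees the full dynamics. *)
Definition scaled_obs (theta x : I) : R := unit_val theta * (1 + unit_val x).

Lemma horseshoe_lipschitz (x y : I) :
  `|unit_val (horseshoe x) - unit_val (horseshoe y)| <= 3 * `|unit_val x - unit_val y|.
Proof.
apply: (le_trans (clamp_lipschitz _ _)).
have := ler_norm (unit_val x - unit_val y).
have := ler_norm (unit_val y - unit_val x); rewrite (distrC (unit_val y)).
move: (unit_val x) (unit_val y) => {}x {}y h1 h2.
have [h3|h3] := leP (3 * x) (3 * (1 - x)); have [h4|h4] := leP (3 * y) (3 * (1 - y));
  by rewrite ler_norml; apply/andP; split; lra.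
Qed.

Lemma continuous_horseshoe : continuous horseshoe.
Proof.
move=> x.
apply/(@metricType_numDomainType.cvgrPdist_lt _ _ _ (nbhs x) (nbhs_filter x)) => e e0.
apply/nbhs_ballP; exists (e / 3); rewrite /= ?divr_gt0// => y.
rewrite ballEmdist /= !mdist_unit_itv => xy.
by apply: (le_lt_trans (horseshoe_lipschitz _ _)); lra.
Qed.

Lemma horseshoe_family :
  continuous_family (fun _ : I => horseshoe) scaled_obs.
Proof.
split; [exact: compact_unit_itv|exact: compact_unit_itv| |].
  move=> z; apply: (@continuous_comp _ _ _ (snd : I * I -> I) horseshoe z).
    exact: cvg_snd.
  exact: continuous_horseshoe.
move=> z.
have c1 : {for z, continuous (fun z : I * I => unit_val z.1 : R^o)}.
  apply: (@continuous_comp _ _ _ (fst : I * I -> I) (@unit_val R) z).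
    exact: cvg_fst.
  exact: continuous_unit_val.
have c2 : {for z, continuous (fun z : I * I => unit_val z.2 : R^o)}.
  apply: (@continuous_comp _ _ _ (snd : I * I -> I) (@unit_val R) z).
    exact: cvg_snd.
  exact: continuous_unit_val.
have c3 : {for z, continuous (fun z : I * I => 1 + unit_val z.2 : R^o)}.
  by apply: (@continuousD _ R^o _ (cst 1) _ z); [exact: cst_continuous|exact: c2].
exact: (@continuousM _ _ _ _ z c1 c3).
Qed.

(** Composition of the two inverse branches [x / 3] and [1 - x / 3]: a point whose itinerary through
    the outer thirds is [w]. *)
Fixpoint coded_point (w : seq bool) : R :=
  if w is b :: w' then (if b then 1 - coded_point w' / 3 else coded_point w' / 3)
  else 0.

Lemma coded_point_itv w : 0 <= coded_point w <= 1.
Proof.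
elim: w => [|b w /andP[h1 h2]]; first by rewrite /= lexx ler01.
by case: b => /=; apply/andP; split; lra.
Qed.

Definition coded w : I := UnitItv (coded_point_itv w).

Lemma horseshoe_coded b w : horseshoe (coded (b :: w)) = coded w.
Proof.
apply: unit_itv_inj; rewrite /horseshoe /=.
have /andP[h1 h2] := coded_point_itv w.
have -> : Num.min (3 * (if b then 1 - coded_point w / 3 else coded_point w / 3))
   (3 * (1 - (if b then 1 - coded_point w / 3 else coded_point w / 3))) = coded_point w.
  by case: b; [rewrite min_r|rewrite min_l]; lra.
by rewrite min_r// max_r.
Qed.

Lemma iter_horseshoe_coded k w : (k <= size w)%N ->
  iter k horseshoe (coded w) = coded (drop k w).
Proof.
elim: k => [|k IH] kw; first by rewrite drop0.
by rewrite iterS IH ?(ltnW kw)// (drop_nth false kw) horseshoe_coded.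
Qed.

(** At time [k] the two points lie in different outer thirds. *)
Lemma coded_separated k (w w' : seq bool) : (k < size w)%N -> (k < size w')%N ->
  nth false w k != nth false w' k ->
  3^-1 <= `|unit_val (iter k horseshoe (coded w)) - unit_val (iter k horseshoe (coded w'))|.
Proof.
move=> kw kw'; rewrite !iter_horseshoe_coded 1?ltnW//.
rewrite (drop_nth false kw) (drop_nth false kw').
have /andP[h1 h2] := coded_point_itv (drop k.+1 w).
have /andP[h3 h4] := coded_point_itv (drop k.+1 w').
case: (nth false w k); case: (nth false w' k) => //= _.
  by rewrite ger0_norm; lra.
by rewrite distrC ger0_norm; lra.
Qed.

Let one : I := clamp 1.

Let one_val : unit_val one = 1.
Proof. by rewrite clampE// ler01 lexx. Qed.

(** At parameter 1 the [2 ^ n] words give orbits at sup distance at least 1/3, and two of them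
    cannot share a center at radius 1/6. This accounts for the rate [ln 2]; the constant 2 bounds
    the observations. *)
Lemma horseshoe_entropy_gt0 (p : \bar R) : (1 <= p)%E ->
  (0 < entropy (fun _ : I => horseshoe) scaled_obs p setT)%E.
Proof.
move=> p1; apply: (@sup_cover_entropy_gt0 _ 2 p _ 6^-1 (ln 2)) => //.
- move=> u k [theta [x [_ ->]]]; rewrite /orbit_seq /scaled_obs.
  have := unit_itv_ge0 theta; have := unit_itv_le1 theta.
  have := unit_itv_ge0 (iter k horseshoe x); have := unit_itv_le1 (iter k horseshoe x).
  move: (unit_val _) (unit_val theta) => y t y1 y0 t1 t0.
  by rewrite ger0_norm; nra.
- by rewrite ln_gt0// ltr1n.
move=> n K n0 [c cP].
rewrite expRM_natr lnK ?posrE// -natrX ler_nat.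
have {}cP (w : n.-tuple bool) : exists i, forall k, (k < n)%N ->
    `|orbit_seq (fun _ : I => horseshoe) scaled_obs one (coded w) k - c i k| < 6^-1.
  by apply: cP; exists one, (coded w).
have /choice[g gP] := cP.
suff g_inj : injective g.
  by have := leq_card g g_inj; rewrite card_tuple card_bool card_ord.
move=> w w' gww'; apply/val_inj/(@eq_from_nth _ false); first by rewrite !size_tuple.
move=> k; rewrite size_tuple => kn; apply/eqP; apply: contraT => nw.
have := @coded_separated k w w'; rewrite !size_tuple => /(_ kn kn nw).
have := gP w k kn; have := gP w' k kn; rewrite -gww' /orbit_seq /scaled_obs one_val !mul1r.
clear p1 gww' nw; move: (unit_val _) (unit_val _) => y y'; rewrite !ltr_norml => /andP[? ?] /andP[? ?].
by rewrite ler_normr => /orP[] ?; lra.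
Qed.

Let zero_seq : seq_space R := fun=> 0.

Let zero_orbit x : orbit_seq (fun _ : I => horseshoe) scaled_obs point x = zero_seq.
Proof. by apply/funext => k; rewrite /orbit_seq /scaled_obs /= mul0r. Qed.

Lemma horseshoe_entropy0 (p : \bar R) : (1 <= p)%E ->
  entropy (fun _ : I => horseshoe) scaled_obs p [set point] = 0%E.
Proof.
move=> p1; rewrite /entropy (_ : mkset _ = [set zero_seq]) ?seq_entropy_set1//.
apply/seteqP; split=> [u [_ [x [-> ->]]]|_ ->]; first exact: zero_orbit.
by exists point, point; split => //; rewrite zero_orbit.
Qed.

Lemma horseshoe_point : horseshoe point = point.
Proof.
apply: unit_itv_inj; rewrite /horseshoe [Num.min _ _](_ : _ = 0).
  by rewrite clampE// lexx ler01.
by rewrite /= mulr0 subr0 mulr1 min_l.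
Qed.

(** The process is identically zero, the image of the point mass at the fixed point 0 of the
    horseshoe. For a positive parameter no process charges the sequences starting with 0. A point
    mass takes only the values 0 and 1, whence ergodicity. *)
Lemma consistent_model_example :
  exists (X Theta : pmetricType R)
      (T : Theta -> X -> X) (f : Theta -> X -> R)
      (theta0 : Theta) (nuV : probability (seq_space R) R),
    [/\ continuous_family T f,
        forall p : \bar R, (1 <= p)%E ->
          (0 < entropy T f p [set: Theta])%E /\
          entropy T f p [set theta0] = 0%E,
        (model_processes T f theta0 `\`
          \bigcup_(theta in [set theta | theta <> theta0])
            model_processes T f theta) nuV
      & ergodic nuV].
Proof.
exists I, I, (fun=> horseshoe), scaled_obs, point, (\d_ zero_seq).
split; first exact: horseshoe_family.
- by move=> p p1; split; [exact: horseshoe_entropy_gt0|exact: horseshoe_entropy0].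
- split.
    exists (\d_ (point : borel I)); split.
      by move=> A mA; apply: eq_dirac; rewrite /= horseshoe_point.
    by move=> A mA; apply: eq_dirac; rewrite /= zero_orbit.
  move=> [theta /= ne [mu [_ muA]]].
  have theta_gt0 : 0 < unit_val theta.
    rewrite lt_neqAle unit_itv_ge0 andbT; apply/eqP => h; apply: ne.
    by apply: unit_itv_inj; rewrite -h.
  pose A : set (seq_space R) := (fun z : seq_space R => z 0%N) @^-1` [set 0].
  have mA : measurable A.
    by rewrite -[X in measurable X]setTI; apply: measurable_coord.
  have := muA A mA; rewrite (_ : _ @^-1` A = set0) ?measure0.
    by rewrite dirac_in// => /eqP; rewrite eqe oner_eq0.
  apply/seteqP; split=> // x /= /eqP; rewrite /orbit_seq /scaled_obs /= mulf_eq0 gt_eqF//=.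
  by rewrite gt_eqF// ltr_wpDr ?unit_itv_ge0.
- split=> [A mA|A mA _].
    exact: eq_dirac.
  exact: dirac_zero_one.
Qed.

End Horseshoe.

Theorem proposition4p5 (R : realType) :
  (forall (p : \bar R) (X Theta : pmetricType R)
      (T : Theta -> X -> X) (f : Theta -> X -> R)
      (theta0 : Theta) (nuV : probability (seq_space R) R),
    (1 <= p)%E ->
    continuous_family T f ->
    (0 < entropy T f p [set: Theta])%E ->
    entropy T f p [set theta0] = 0%E ->
    (model_processes T f theta0 `\`
      \bigcup_(theta in [set theta | theta <> theta0])
        model_processes T f theta) nuV ->
    ergodic nuV ->
    exists sigma0 : R, 0 < sigma0 /\
      forall (sigma : R) (d : measure_display) (Omega : measurableType d)
          (P : probability Omega R) (V eps : nat -> {RV P >-> R}),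
        sigma0 < sigma ->
        has_law V nuV ->
        iid_centered_normal eps sigma ->
        independent_processes V eps ->
        let Y : nat -> Omega -> R := fun k w => V k w + eps k w in
        exists Theta_star : set Theta,
          [/\ compact Theta_star,
              Theta_star !=set0,
              forall theta_ : forall n : nat, n.-tuple R -> Theta,
                least_squares_estimates T f P Y theta_ ->
                {ae P, forall w,
                  dist_to_set Theta_star (estimate theta_ (Y ^~ w) n)
                    @[n --> \oo] --> 0%E}
            & ~ (\bigcup_(theta in Theta_star)
                   model_processes T f theta) nuV])
  /\
  (exists (X Theta : pmetricType R)
      (T : Theta -> X -> X) (f : Theta -> X -> R)
      (theta0 : Theta) (nuV : probability (seq_space R) R),
    [/\ continuous_family T f,
        forall p : \bar R, (1 <= p)%E ->
          (0 < entropy T f p [set: Theta])%E /\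
          entropy T f p [set theta0] = 0%E,
        (model_processes T f theta0 `\`
          \bigcup_(theta in [set theta | theta <> theta0])
            model_processes T f theta) nuV
      & ergodic nuV]).
Proof.
split; last exact: consistent_model_example.
move=> p X Theta T f theta0 nuV p1 cont hD h0 modelV _.
have [sigma0 [sigma0_gt0 H]] := least_squares_inconsistent p1 cont hD h0 modelV.
exists sigma0; split=> // sigma d Omega P V eps hs lawV iid _.
exact: (H sigma d Omega P V eps hs lawV iid).
Qed.
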